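(* Let $G=(N,E)$ be a finite simple graph with weights $w:N\to\mathbb{R}_{++}$. Let $(x^*,X^* )$ and $(t^*,q^*,Q^* )$ be optimal solutions of (SDP-P) and (SDP-D) respectively, each in the relative interior of the optimal face (the set of optimal solutions) of its feasible region, and let $\mathcal{V}_{\mathrm{SDP}}$ be the set function $\mathcal{V}_{\mathrm{SDP}}(S)=(q^*_S)^\top (Q^*_S)^\dagger q^*_S$ for $\emptyset\ne S\subseteq N$, $\mathcal{V}_{\mathrm{SDP}}(\emptyset)=0$. Consider the Rounding Algorithm executed with input $x^*$ and $\mathcal{V}_{\mathrm{SDP}}$. (a) If $G$ is unipolar, chordal, or co-chordal, then the Rounding Algorithm returns a maximum weighted stable set of $G$ (whatever arbitrary choices are made during its execution). (b) Assume $G$ is co-unipolar, and let $i,j$ be any two adjacent vertices remaining after Phase I. Then either the Rounding Algorithm returns a maximum weighted stable set whenever Phase II starts by selecting $i$ (i.e. $i$ is the vertex chosen in step (1) of the first iteration), or it returns a maximum weighted stable set whenever Phase II starts by selecting $j$.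
   Context: For a vertex $i$, $\delta_i$ is the set of neighbors of $i$ in $G$. A maximum weighted stable set (MWSS) is a stable set $S$ maximizing $\sum_{i\in S}w_i$; $\alpha(I)$ is the maximum weight of a stable set of the induced subgraph $G|_I$. For $q\in\mathbb{R}^N$ and a symmetric $N\times N$ matrix $Q$, $q_S$ and $Q_S$ are the subvector and principal submatrix indexed by $S$; $\dagger$ is the Moore–Penrose pseudo-inverse. (SDP-P): maximize $w^\top x$ over $x\in\mathbb{R}^N$ and symmetric $X$ subject to $X_{ii}=x_i$ for $i\in N$, $X_{ij}=0$ for $ij\in E$, $X-xx^\top\succeq 0$. (SDP-D): minimize $t$ over $t\in\mathbb{R}$, $q\in\mathbb{R}^N$, symmetric $Q$ subject to $Q_{ii}=-2q_i-w_i$ for $i\in N$, $Q_{ij}=0$ for $i\ne j$ with $ij\notin E$, and $\begin{pmatrix}t&q^\top\\ q&Q\end{pmatrix}\succeq 0$. Graph classes: $G$ is unipolar if $N=A\cup\overline{A}$ (a partition) where $G|_A$ is complete and every connected component of $G|_{\overline{A}}$ is complete; co-unipolar if its complement is unipolar; chordal if it has no induced cycle of length at least four; co-chordal if its complement is chordal. (All these graphs are perfect.) Value function approximation (VFA): a function $\mathcal{V}:2^N\to\mathbb{R}_+$ with $\mathcal{V}(\emptyset)=0$, monotone under inclusion, and $\mathcal{V}(S)-\mathcal{V}(S\setminus(\{i\}\cup\delta_i))\ge w_i$ for all $S\subseteq N$, $i\in S$. It is tight if $\mathcal{V}(N)=\alpha(N)$. Rounding Algorithm. Input: $G$, $w$,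 a maximizer $x^*$ of $w^\top x$ over the convex hull of incidence vectors of stable sets of $G$, and a tight VFA $\mathcal{V}$. Phase I: $S\gets\emptyset$, $I\gets\{i\in N: x^*_i>0\}$. Phase II: while $I\ne\emptyset$, perform one iteration: (1) set $I'\gets I$, choose an arbitrary $i\in I'$, and set $I'\gets I'\setminus(\{i\}\cup\delta_i)$; (2) while there is $j\in I'$ with $\mathcal{V}(I')-\mathcal{V}(I'\setminus(\{j\}\cup\delta_j))>w_j$, pick such a $j$ and set $I'\gets I'\setminus\{j\}$; (3) (look-ahead) if $\mathcal{V}(I)>\mathcal{V}(I')+w_i$, set $I\gets I\setminus\{i\}$; otherwise set $I\gets I'$ and $S\gets S\cup\{i\}$. Output: $S$. *)

(* Defs.v *)
From HB Require Import structures.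
From mathcomp Require Import all_boot all_order all_algebra.
From mathcomp Require Import all_classical all_reals all_analysis.

Set Implicit Arguments.
Unset Strict Implicit.
Unset Printing Implicit Defensive.

Import Order.TTheory GRing.Theory Num.Theory.
Import numFieldNormedType.Exports.

Local Open Scope classical_set_scope.
Local Open Scope ring_scope.

(* A simple graph on the vertex set ['I_n] is given by its adjacency relation
   [e]; that [e] is symmetric and irreflexive is a separate hypothesis. *)

Section Graphs.
Context {n : nat}.
Implicit Types (e : rel 'I_n) (A B I S : {set 'I_n}).

Definition neighbors e (i : 'I_n) : {set 'I_n} := [set j | e i j]%SET.

Definition closed_nbh e (i : 'I_n) : {set 'I_n} := (i |: neighbors e i)%SET.

Definition complement e : rel 'I_n := fun i j => (i != j) && ~~ e i j.

Definition stable e S : Prop := {in S &, forall i j, ~~ e i j}.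

Definition clique e A : Prop := {in A &, forall i j, i != j -> e i j}.

Definition component e B (i : 'I_n) : {set 'I_n} :=
  [set j in B | connect [rel u v | [&& u \in B, v \in B & e u v]] i j]%SET.

Definition unipolar e : Prop :=
  exists A : {set 'I_n},
    clique e A /\ {in (~: A)%SET, forall i, clique e (component e (~: A)%SET i)}.

(* For [size c < 3] these are degenerate closed walks, not cycles; [chordal] only
   looks at [size c >= 4]. *)
Definition induced_cycle e (c : seq 'I_n) : Prop :=
  ucycle e c /\
  {in c &, forall u v, e u v -> (v == next c u) || (u == next c v)}.

Definition chordal e : Prop :=
  forall c : seq 'I_n, induced_cycle e c -> (size c < 4)%N.

Definition counipolar e : Prop := unipolar (complement e).

Definition cochordal e : Prop := chordal (complement e).

End Graphs.

Section RealDefs.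
Context {R : realType}.

Definition weight {n : nat} (w : 'cV[R]_n) (S : {set 'I_n}) : R :=
  \sum_(i in S) w i 0.

Definition mwss {n : nat} (e : rel 'I_n) (w : 'cV[R]_n) (S : {set 'I_n}) :
    Prop :=
  stable e S /\ forall S' : {set 'I_n}, stable e S' -> weight w S' <= weight w S.

Definition psd {n : nat} (A : 'M[R]_n) : Prop :=
  A^T = A /\ forall v : 'cV[R]_n, 0 <= (v^T *m A *m v) 0 0.

Definition penrose {m n : nat} (A : 'M[R]_(m, n)) (B : 'M[R]_(n, m)) : Prop :=
  [/\ A *m B *m A = A, B *m A *m B = B,
      (A *m B)^T = A *m B & (B *m A)^T = B *m A].

(* [xget] picks the matrix satisfying the Penrose conditions; it exists and is
   unique, see [mpinvP] and [penrose_unique]. *)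
Definition mpinv {m n : nat} (A : 'M[R]_(m, n)) : 'M[R]_(n, m) :=
  xget 0 [set B | penrose A B].

Lemma penrose_unique {m n : nat} (A : 'M[R]_(m, n)) (B C : 'M[R]_(n, m)) :
  penrose A B -> penrose A C -> B = C.
Proof.
move=> [ABA BAB ABt BAt] [ACA CAC ACt CAt].
have EAB : A *m B = A *m C.
  by rewrite -ABt -{1}ACA -(mulmxA _ A B) trmx_mul ABt ACt !mulmxA ABA.
have EBA : B *m A = C *m A.
  by rewrite -BAt -{1}ACA -(mulmxA A C A) mulmxA trmx_mul BAt CAt -mulmxA
             (mulmxA A B A) ABA.
by rewrite -BAB EBA -mulmxA EAB mulmxA CAC.
Qed.

Lemma gram_unitmx {m r : nat} (B : 'M[R]_(r, m)) :
  row_free B -> B *m B^T \in unitmx.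
Proof.
move=> freeB; rewrite -row_free_unit -kermx_eq0; apply/eqP/row_matrixP => k.
rewrite row0; set u := row k _.
have u0 : u *m (B *m B^T) = 0 by rewrite -row_mul mulmx_ker row0.
have : (u *m B *m (u *m B)^T) 0 0 = 0.
  by rewrite trmx_mul mulmxA -(mulmxA u) u0 mul0mx mxE.
rewrite mxE => /eqP; rewrite psumr_eq0; last first.
  by move=> j _; rewrite !mxE -expr2 sqr_ge0.
move=> /allP uB0; apply: (row_free_inj freeB); rewrite mul0mx.
apply/rowP => j; have := uB0 j (mem_index_enum _).
by rewrite /= [X in _ * X]mxE -expr2 sqrf_eq0 => /eqP ->; rewrite mxE.
Qed.

Lemma penrose_exists {m n r : nat} (C : 'M[R]_(m, r)) (B : 'M[R]_(r, n)) :
  row_full C -> row_free B -> exists D, penrose (C *m B) D.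
Proof.
move=> fullC freeB; have uB := gram_unitmx freeB.
have uC : C^T *m C \in unitmx.
  rewrite -{2}(trmxK C); apply: gram_unitmx.
  by rewrite /row_free mxrank_tr; exact: fullC.
pose L := invmx (C^T *m C) *m C^T; pose M := B^T *m invmx (B *m B^T).
have LC : L *m C = 1%:M by rewrite -mulmxA mulVmx.
have BM : B *m M = 1%:M by rewrite mulmxA mulmxV.
exists (M *m L).
have AB : C *m B *m (M *m L) = C *m L.
  by rewrite mulmxA -(mulmxA C) BM mulmx1.
have BA : M *m L *m (C *m B) = M *m B.
  by rewrite mulmxA -(mulmxA M) LC mulmx1.
split.
- by rewrite AB mulmxA -(mulmxA C) LC mulmx1.
- by rewrite BA mulmxA -(mulmxA M) BM mulmx1.
- by rewrite AB !trmx_mul trmxK trmx_inv trmx_mul trmxK mulmxA.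
- by rewrite BA !trmx_mul trmxK trmx_inv trmx_mul trmxK mulmxA.
Qed.

Lemma mpinvP {m n : nat} (A : 'M[R]_(m, n)) : penrose A (mpinv A).
Proof.
have [B] := penrose_exists (col_base_full A) (row_base_free A).
rewrite mulmx_base => pB.
exact: (@xgetPex _ 0 [set B | penrose A B] (ex_intro _ B pB)).
Qed.

Definition affine_hull {V : lmodType R} (C : set V) : set V :=
  [set x | exists (k : nat) (v : 'I_k -> V) (a : 'I_k -> R),
     [/\ forall i, C (v i), \sum_i a i = 1 & x = \sum_i a i *: v i]].

Definition relative_interior {V : normedModType R} (C : set V) : set V :=
  [set x | C x /\ \forall y \near x, affine_hull C y -> C y].

Section SDP.
Context {n : nat}.
Variables (e : rel 'I_n) (w : 'cV[R]_n).

Definition primal_feasible : set ('cV[R]_n * 'M[R]_n) :=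
  [set p : 'cV[R]_n * 'M[R]_n | let: (x, X) := p in
     [/\ X^T = X,
         forall i, X i i = x i 0,
         forall i j, e i j -> X i j = 0
       & psd (X - x *m x^T)]].

Definition primal_optimal : set ('cV[R]_n * 'M[R]_n) :=
  [set p | primal_feasible p /\
     forall p', primal_feasible p' -> (w^T *m p'.1) 0 0 <= (w^T *m p.1) 0 0].

Definition dual_feasible : set (R * 'cV[R]_n * 'M[R]_n) :=
  [set p : R * 'cV[R]_n * 'M[R]_n | let: (t, q, Q) := p in
     [/\ Q^T = Q,
         forall i, Q i i = - 2 * q i 0 - w i 0,
         forall i j, i != j -> ~~ e i j -> Q i j = 0
       & psd (block_mx t%:M q^T q Q)]].

Definition dual_optimal : set (R * 'cV[R]_n * 'M[R]_n) :=
  [set p | dual_feasible p /\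
     forall p', dual_feasible p' -> p.1.1 <= p'.1.1].

End SDP.

Definition subvec {n : nat} (q : 'cV[R]_n) (S : {set 'I_n}) : 'cV[R]_#|S| :=
  \col_k q (enum_val k) 0.

Definition submat {n : nat} (Q : 'M[R]_n) (S : {set 'I_n}) : 'M[R]_#|S| :=
  \matrix_(k, l) Q (enum_val k) (enum_val l).

Definition V_SDP {n : nat} (q : 'cV[R]_n) (Q : 'M[R]_n) (S : {set 'I_n}) : R :=
  if S == finset.set0 then 0
  else ((subvec q S)^T *m mpinv (submat Q S) *m subvec q S) 0 0.

Section Rounding.
Context {n : nat}.
Variables (e : rel 'I_n) (w : 'cV[R]_n) (V : {set 'I_n} -> R).
Implicit Types (I J S : {set 'I_n}).

Definition removable I (j : 'I_n) : Prop :=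
  j \in I /\ V I - V (I :\: closed_nbh e j)%SET > w j 0.

(* [prune I J]: the loop of step (2), started with I' = I, can end with I' = J *)
Inductive prune : {set 'I_n} -> {set 'I_n} -> Prop :=
| prune_stop I : (forall j, ~ removable I j) -> prune I I
| prune_step I (j : 'I_n) J :
    removable I j -> prune (I :\ j)%SET J -> prune I J.

(* [iteration i I S I1 S1]: one iteration of Phase II that chooses [i] in
   step (1) can lead from the state (I, S) to the state (I1, S1) *)
Inductive iteration (i : 'I_n) I S : {set 'I_n} -> {set 'I_n} -> Prop :=
| iteration_discard J :
    i \in I -> prune (I :\: closed_nbh e i)%SET J ->
    V I > V J + w i 0 -> iteration i I S (I :\ i)%SET S
| iteration_select J :
    i \in I -> prune (I :\: closed_nbh e i)%SET J ->
    ~~ (V I > V J + w i 0) -> iteration i I S J (i |: S)%SET.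

Inductive phase2 : {set 'I_n} -> {set 'I_n} -> {set 'I_n} -> Prop :=
| phase2_stop S : phase2 finset.set0 S S
| phase2_step (i : 'I_n) I S I1 S1 Sout :
    iteration i I S I1 S1 -> phase2 I1 S1 Sout -> phase2 I S Sout.

Definition phase1 (x : 'cV[R]_n) : {set 'I_n} := [set i | 0 < x i 0]%SET.

Definition rounding_returns (x : 'cV[R]_n) (Sout : {set 'I_n}) : Prop :=
  phase2 (phase1 x) finset.set0 Sout.

Definition rounding_returns_from (i : 'I_n) (x : 'cV[R]_n)
    (Sout : {set 'I_n}) : Prop :=
  exists I1 S1, iteration i (phase1 x) finset.set0 I1 S1 /\ phase2 I1 S1 Sout.

(* Every loop strictly shrinks its set, so executions cannot diverge; the next
   lemmas show that they cannot get stuck either. *)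
Lemma prune_total I : exists2 J, prune I J & J \subset I.
Proof.
have [k] := ubnP #|I|; elim: k I => // k IH I ltIk.
have [[j rj]|noj] := pselect (exists j, removable I j); last first.
  by exists I => //; apply: prune_stop => j rj; apply: noj; exists j.
have [|J pJ sJ] := IH (I :\ j)%SET.
  by move: ltIk; rewrite (cardsD1 j I) rj.1.
exists J; first exact: prune_step rj pJ.
exact: fintype.subset_trans sJ (subD1set _ _).
Qed.

Lemma iteration_total (i : 'I_n) I S : i \in I ->
  exists I1 S1, iteration i I S I1 S1 /\ (#|I1| < #|I|)%N.
Proof.
move=> iI; have [J pJ sJ] := prune_total (I :\: closed_nbh e i)%SET.
have [gt|ngt] := boolP (V I > V J + w i 0).
  exists (I :\ i)%SET, S; split; first exact: iteration_discard pJ gt.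
  by rewrite (cardsD1 i I) iI.
exists J, (i |: S)%SET; split; first exact: iteration_select pJ ngt.
rewrite (cardsD1 i I) iI ltnS; apply: subset_leq_card.
apply: fintype.subset_trans sJ _; apply: finset.setDS.
by rewrite finset.sub1set setU11.
Qed.

Lemma phase2_total I S : exists Sout, phase2 I S Sout.
Proof.
have [k] := ubnP #|I|; elim: k I S => // k IH I S ltIk.
have [->|[i iI]] := set_0Vmem I; first by exists S; exact: phase2_stop.
have [I1 [S1 [it lt1]]] := iteration_total S iI.
have [|Sout p] := IH I1 S1; first exact: leq_trans lt1 _.
by exists Sout; exact: phase2_step it p.
Qed.

Lemma rounding_returns_total (x : 'cV[R]_n) :
  exists Sout, rounding_returns x Sout.
Proof. exact: phase2_total. Qed.

Lemma rounding_returns_from_total (i : 'I_n) (x : 'cV[R]_n) :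
  i \in phase1 x -> exists Sout, rounding_returns_from i x Sout.
Proof.
move=> ix; have [I1 [S1 [it _]]] := iteration_total finset.set0 ix.
by have [Sout p] := phase2_total I1 S1; exists Sout, I1, S1.
Qed.

End Rounding.
End RealDefs.

(* Main.v *)
(* Let f(z) = z^T Q z + 2 q^T z.  Then V_SDP(S) is minus the minimum of f over the
   vectors supported on S, and every property of V_SDP comes from this.

   In all four graph classes every weight w is exactly covered by cliques at
   total cost alpha(w).  By a perturbation argument it suffices to find one
   "tight" clique, meeting all maximum weighted stable sets (MWSS), and this
   passes to the complementary graph (Lovasz).  Such a cover gives an optimal
   solution of (SDP-D), whence t = alpha; since (t, q, Q) lies in the relative
   interior, f(z) = -t forces z(C) = 1 for every tight clique C.

   When the algorithm has chosen S and is left with a pruned set J such that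
   V(J) + w(S) = t, minimizers of f on J \ N[k] and on J, extended by S, show
   that every tight clique meets S or J, and meets S or J \ N(k) for each k in J.
   In each class this combinatorial condition alone yields a stable T in J such
   that S and T together form an MWSS, so the algorithm never loses track of the
   optimum.  In the co-unipolar case, one of two adjacent vertices lies outside
   the part that is stable in G; starting there leaves a bipartite graph. *)

Require Import Defs.
From mathcomp Require Import all_boot all_order all_algebra.
From mathcomp Require Import all_classical all_reals all_analysis.
From mathcomp Require Import ring lra.
From mathcomp Require Import fintype finset.

Set Implicit Arguments.
Unset Strict Implicit.
Unset Printing Implicit Defensive.

Import Order.TTheory GRing.Theory Num.Theory.
Import numFieldNormedType.Exports.
Local Open Scope ring_scope.

(** * Chordal graphs *)

Section Connectivity.
Context {n : nat} {e : rel 'I_n} (e_sym : symmetric e) (e_irr : irreflexive e).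
Implicit Types (A B C D H J M S T X Y : {set 'I_n}) (i j k u v z : 'I_n).

(** Connectivity is stated through cuts, so that it can be used by growing a subset until an edge
    must leave it. The empty set qualifies. *)
Definition cut_connected D : Prop :=
  forall A, A \subset D -> A != set0 -> A != D ->
  exists a b, [/\ a \in A, b \in D, b \notin A & e a b].

Lemma in_setD_nbh X k j :
  (j \in X :\: closed_nbh e k) = [&& j \in X, j != k & ~~ e k j].
Proof. by rewrite in_setD in_setU1 inE negb_or andbC. Qed.

Lemma component_sub B i : component e B i \subset B.
Proof. by apply/subsetP => j; rewrite inE => /andP[]. Qed.

Lemma component_refl B i : i \in B -> i \in component e B i.
Proof. by move=> iB; rewrite inE iB connect0. Qed.

Lemma component_closed B i j k :
  j \in component e B i -> k \in B -> e j k -> k \in component e B i.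
Proof.
rewrite !inE => /andP[jB ij] kB jk; rewrite kB.
by apply: connect_trans ij _; apply: connect1; rewrite /= jB kB.
Qed.

Lemma component_connected B i : cut_connected (component e B i).
Proof.
move=> A sAD /set0Pn[a aA] nAD; apply: contrapT => noedge.
have clA u v : u \in A -> v \in component e B i -> e u v -> v \in A.
  move=> uA vD uv; apply: contrapT => /negP vA.
  by apply: noedge; exists u, v.
have clAr : fingraph.closed [rel u v | [&& u \in B, v \in B & e u v]] (mem A).
  move=> u v /and3P[uB vB uv]; apply/idP/idP => [uA|vA].
    by apply: (clA u) => //; apply: component_closed uv => //; apply: (subsetP sAD).
  have vu : e v u by rewrite e_sym.
  by apply: (clA v) => //; apply: component_closed vu => //; apply: (subsetP sAD).
have csym : connect_sym [rel u v | [&& u \in B, v \in B & e u v]].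
  by apply: sym_connect_sym => u v; rewrite /= e_sym andbCA.
case/negP: nAD; rewrite eqEsubset sAD; apply/subsetP => b.
rewrite inE => /andP[_ ib]; have := subsetP sAD _ aA.
rewrite inE csym => /andP[_ ai].
by rewrite -(closed_connect clAr (connect_trans ai ib)).
Qed.

(* A shortest path from [z] to [z'] through [D], closed up at [v], would be an
   induced cycle. *)
Lemma chordal_common_neighbors D v z z' :
  chordal e -> cut_connected D -> v \notin D -> {in D, forall d, ~~ e v d} ->
  e v z -> e v z' -> (exists2 d, d \in D & e z d) ->
  (exists2 d, d \in D & e z' d) -> z != z' -> e z z'.
Proof.
move=> chord conD vD vnD vz vz' [d dD zd] [d' d'D z'd'] zz'.
(* Induction on a length bound: a path with a chord gives way to a shorter one, so only chordless
   paths have to be closed up. *)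
have key m (p : seq 'I_n) : (size p < m)%N -> path e z p ->
    all (mem (z' |: D)) p -> last z p = z' -> e z z'.
  elim: m p => // m IH p0 szp0 pp0 allp0 lastp0.
  case/shortenP: pp0 lastp0 => p pp up sub lastp.
  have szp : (size p < m.+1)%N.
    by apply: leq_ltn_trans szp0;
    rewrite uniq_leq_size //; case/andP: up.
  have allp : all (mem (z' |: D)) p.
    by apply/allP => y yp; apply: (allP allp0); apply: sub.
  apply: contrapT => /negP nzz'.
  (* Here [i] counts along [z :: p] and [j] along [p], so [i < j] means that the chord skips at
     least one vertex. *)
  have nochord (i j : nat) : (i < j)%N -> (j < size p)%N ->
      ~~ e (nth v (z :: p) i) (nth v p j).
    move=> ij jp; apply/negP => eij; case/negP: nzz'.
    have ip : (i <= size p)%N by apply: ltnW; apply: ltn_trans jp.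
    have lasti : last z (take i p) = nth v (z :: p) i.
      by rewrite (last_nth v) size_takel // -[z :: take i p]/(take i.+1 (z :: p)) nth_take.
    apply: (IH (take i p ++ drop j p)).
    - rewrite size_cat size_takel // size_drop.
      apply: leq_trans (_ : (size p <= m)%N); last by [].
      by rewrite -{2}(subnKC (ltnW jp)) ltn_add2r.
    - rewrite cat_path lasti (drop_nth v jp) /= eij.
      move: (pp); rewrite -{1}(cat_take_drop i p) cat_path => /andP[-> _] /=.
      by move: (pp); rewrite -{1}(cat_take_drop j p) cat_path (drop_nth v jp) /= => /and3P[].
    - by rewrite all_cat; apply/andP; split; apply/allP => y;
         [move=> /mem_take|move=> /mem_drop] => yp; apply: (allP allp).
    - by rewrite last_cat -lastp -{3}(cat_take_drop j p) last_cat (drop_nth v jp).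
  have vp : v \notin z :: p.
    rewrite inE negb_or; apply/andP; split.
      by apply/eqP => vz0; rewrite -vz0 e_irr in vz.
    apply/negP => /(allP allp); rewrite /= inE (negbTE vD) orbF inE => /eqP vz0.
    by rewrite -vz0 e_irr in vz'.
  have uc : uniq (v :: z :: p) by rewrite cons_uniq vp.
  have /chord : induced_cycle e (v :: z :: p).
    split.
      by apply/andP; split=> //; rewrite /= rcons_path vz pp lastp e_sym vz'.
    (* The default value [v] of [nth] makes [v] the successor of the last vertex, which closes the
       cycle. *)
    have nextE u : u \in v :: z :: p ->
        next (v :: z :: p) u = nth v (v :: z :: p) (index u (v :: z :: p)).+1.
      by move=> uin; rewrite next_nth uin.
    have nthD (j : nat) : (j < size p)%N -> e v (nth v p j) -> nth v p j = z'.
      move=> jp; have := allP allp _ (mem_nth v jp).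
      by rewrite /= !inE => /orP[/eqP//|/vnD/negbTE->].
    have half (i j : nat) : (i < size (v :: z :: p))%N -> (j < size (v :: z :: p))%N ->
        e (nth v (v :: z :: p) i) (nth v (v :: z :: p) j) -> (i < j)%N ->
        (nth v (v :: z :: p) j == nth v (v :: z :: p) i.+1) ||
        (nth v (v :: z :: p) i == nth v (v :: z :: p) j.+1).
      rewrite [size _]/= => ip jp.
      case: j jp => [|j] jp; first by rewrite ltn0.
      case: i ip => [|i] ip.
        case: j jp => [|j] jp /=; first by rewrite eqxx.
        move=> ej _; apply/orP; right.
        have jz := nthD j jp ej.
        suff -> : j.+1 = size p by rewrite nth_default.
        apply/eqP; rewrite eqn_leq; apply/andP; split; first by rewrite -ltnS.
        rewrite leqNgt; apply/negP => jlt.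
        have lt0 : (0 < size p)%N by apply: leq_ltn_trans jlt.
        have last' : nth v p (size p).-1 = z' by rewrite nth_last -lastp; case: (p) lt0.
        have upp : uniq p by case/andP: up.
        have lt1 : ((size p).-1 < size p)%N by rewrite prednK.
        move: jz; rewrite -last' => /eqP; rewrite nth_uniq // => /eqP jE.
        by move: jlt; rewrite jE prednK // ltnn.
      rewrite !ltnS in ip jp => eij; rewrite ltnS => ij.
      case: j jp eij ij => // j jp eij; rewrite ltnS => ij.
      move: ij; rewrite leq_eqVlt => /orP[/eqP->|ij]; first by rewrite /= eqxx.
      by have /negP := nochord i j ij jp.
    move=> u u' uin u'in uu'; rewrite !nextE //.
    have := half (index u (v :: z :: p)) (index u' (v :: z :: p)).
    have := half (index u' (v :: z :: p)) (index u (v :: z :: p)).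
    rewrite !index_mem !nth_index // => h1 h2.
    case: (ltngtP (index u (v :: z :: p)) (index u' (v :: z :: p))).
    - by move=> lt; rewrite h2.
    - by move=> lt; rewrite orbC h1 // e_sym.
    - by move=> ixE; have uE := index_inj v uin u'in ixE; rewrite uE e_irr in uu'.
  rewrite /= !ltnS; case: p {pp up sub allp szp nochord vp uc} lastp (pp) => [|y [|//]] /=.
    by move=> zz0; rewrite zz0 eqxx in zz'.
  by move=> -> /andP[zz0 _] _; rewrite zz0 in nzz'.
(* Only the target of a step has to lie in [D], since the path starts at [z]. *)
pose r0 := [rel u x | e u x && (x \in D)].
have AD : [set x in D | connect r0 z x] = D.
  apply/eqP; apply: contrapT => /negP nA.
  have [||a [b [aA bD bA ab]]] := conD _ _ _ nA.
  - by apply/subsetP => x; rewrite inE => /andP[].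
  - by apply/set0Pn; exists d; rewrite inE dD; apply: connect1; rewrite /= zd.
  case/negP: bA; rewrite inE bD; move: aA; rewrite inE => /andP[_ za].
  by apply: connect_trans za _; apply: connect1; rewrite /= ab.
move: (d'D); rewrite -{1}AD inE => /andP[_ /connectP[p pp d'E]].
apply: (key (size (rcons p z')).+1 (rcons p z')) => //.
- rewrite rcons_path -d'E e_sym z'd' andbT.
  by apply: sub_path pp => x y /andP[].
- have allD : all (mem D) p.
    by elim: (p) (z) pp => //= x s IH x0 /andP[/andP[_ ->]] /IH.
  rewrite all_rcons /= !inE eqxx /=; apply/allP => y yp.
  by have := allP allD _ yp; rewrite /= !inE => ->; rewrite orbT.
- by rewrite last_rcons.
Qed.

End Connectivity.

(** * Simplicial vertices and stable transversals in chordal graphs *)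

Section Chordal.
Context {n : nat} {e : rel 'I_n} (e_sym : symmetric e) (e_irr : irreflexive e)
  (e_chordal : chordal e).
Implicit Types (A B C D H J M S T X Y : {set 'I_n}) (i j k u v z : 'I_n).

(** Choose [k] in [D] with the most neighbours in [Z]. If [k] missed some [z], the region reached
    from [z] while avoiding every vertex that sees all [Z]-neighbours of [k] would nevertheless
    contain such a vertex. *)
Lemma chordal_complete_vertex D Z :
  cut_connected (e := e) D -> D != set0 -> clique e Z ->
  {in Z, forall z, z \notin D /\ exists2 d, d \in D & e z d} ->
  exists2 k, k \in D & {in Z, forall z, e k z}.
Proof.
move=> conD /set0Pn[d0 d0D] clZ nbrZ.
case: (@arg_maxnP _ d0 (fun k => k \in D) (fun k => #|neighbors e k :&: Z|) d0D) => k kD kmax.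
exists k => // z zZ; apply: contrapT => /negP nkz.
have [zD [d dD zd]] := nbrZ z zZ.
(* By maximality of [k], no vertex of [Y] sees [z]. *)
pose Y := [set p in D | neighbors e k :&: Z \subset neighbors e p].
have kY : k \in Y by rewrite inE kD subsetIl.
have nYz p : p \in Y -> ~~ e p z.
  rewrite inE => /andP[pD sub]; apply/negP => pz.
  have : (#|neighbors e p :&: Z| <= #|neighbors e k :&: Z|)%N := kmax p pD.
  rewrite leqNgt => /negP; apply.
  apply: proper_card; apply/properP; split.
    by rewrite subsetI sub subsetIr.
  by exists z; rewrite !inE ?pz ?zZ // (negbTE nkz).
pose D3 := component e ((z |: D) :\: Y) z.
have zY : z \notin Y by rewrite inE (negbTE zD).
have zD3 : z \in D3 by apply: component_refl; rewrite inE zY setU11.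
have D3Y j : j \in D3 -> j \notin Y.
  by move/(subsetP (component_sub _ _)); rewrite inE => /andP[].
have D3D j : j \in D3 -> j != z -> j \in D.
  by move/(subsetP (component_sub _ _)); rewrite !inE => /andP[_ /orP[->|]].
have [y [d1 [yY d1D3 d1y]]] : exists y d1, [/\ y \in Y, d1 \in D3 & e d1 y].
  have [||a [b [aA bD bA ab]]] := conD (D3 :&: D) (subsetIr _ _).
  - apply/set0Pn; exists d; rewrite inE dD andbT.
    apply: (component_closed zD3) => //; rewrite !inE dD orbT !andbT /=.
    by apply/negP => dZ; have := nYz d; rewrite inE dD /= e_sym zd => /(_ dZ).
  - by apply/eqP => DE; have := kD; rewrite -DE inE => /andP[/D3Y]; rewrite kY.
  move: aA; rewrite inE => /andP[aD3 _].
  have [bY|bY] := boolP (b \in Y); first by exists b, a.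
  case/negP: bA; rewrite inE bD andbT.
  by apply: (component_closed aD3) => //; rewrite in_setD bY !inE bD orbT.
have yD : y \in D by move: yY; rewrite inE => /andP[].
(* An edge leaving [D4] inside [D3] must end at a neighbour [b] of [y]. Then [b] and any [m] in [Z]
   adjacent to [k] both see [y] and [D4], and chordality joins them; so [b] belongs to [Y]. *)
pose D4 := component e (D3 :\: neighbors e y) z.
have zD4 : z \in D4 by apply: component_refl; rewrite in_setD zD3 inE nYz.
have D4E j : j \in D4 -> ~~ e y j /\ j \in D3.
  by move/(subsetP (component_sub _ _)); rewrite in_setD inE => /andP[].
have conD3 : cut_connected (e := e) D3 by apply: component_connected.
have conD4 : cut_connected (e := e) D4 by apply: component_connected.
have [|||a [b [aD4 bD3 bD4 ab]]] := conD3 D4.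
- by apply/subsetP => j /D4E[].
- by apply/set0Pn; exists z.
- by apply/eqP => DE; have := d1D3; rewrite -DE => /D4E[]; rewrite e_sym d1y.
have yb : e y b.
  apply: contrapT => /negP nyb; case/negP: bD4.
  by apply: component_closed aD4 _ ab; rewrite in_setD bD3 inE nyb.
have bz : b != z by apply: contraL yb => /eqP ->; apply: nYz.
case/negP: (D3Y b bD3); rewrite inE (D3D b) //; apply/subsetP => m.
rewrite !inE => /andP[km mZ].
have ym : e y m.
  by move: yY; rewrite inE => /andP[_ /subsetP/(_ m)]; rewrite !inE km mZ; apply.
have [mD _] := nbrZ m mZ.
apply: (chordal_common_neighbors e_sym e_irr e_chordal conD4 _ _ yb ym).
- by apply/negP => /D4E[_ /D3Y]; rewrite yY.
- by move=> j /D4E[].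
- by exists a => //; rewrite e_sym.
- by exists z => //; apply: clZ => //; apply: contraNneq nkz => <-.
- by apply: contraNneq mD => <-; apply: D3D.
Qed.

Definition simplicial H s := s \in H /\ clique e (H :&: neighbors e s).

(* Dirac's argument *)
Lemma chordal_simplicial_far H v u :
  v \in H -> u \in H -> u != v -> ~~ e v u ->
  exists s, [/\ simplicial H s, s != v & ~~ e v s].
Proof.
have [m] := ubnP #|H|; elim: m H v u => // m IH H v u ltH vH uH uv nvu.
(* The boundary [Z] of this part of [H] consists of neighbours of [v], hence is a clique by
   chordality. *)
pose D := component e (H :\: closed_nbh e v) u.
have conD : cut_connected (e := e) D by apply: component_connected.
have uD : u \in D by apply: component_refl; rewrite in_setD_nbh uH uv nvu.
have DE j : j \in D -> [/\ j \in H, j != v & ~~ e v j].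
  by move/(subsetP (component_sub _ _)); rewrite in_setD_nbh => /and3P[].
pose Z := [set z in H :\: D | [exists d in D, e z d]].
have ZE z : z \in Z -> [/\ z \in H, z \notin D, e v z & exists2 d, d \in D & e z d].
  rewrite in_set in_setD => /andP[/andP[zD zH] /exists_inP[d dD zd]].
  split=> //; last by exists d.
  apply: contrapT => /negP nvz; case/negP: zD.
  have dz : e d z by rewrite e_sym.
  apply: (component_closed dD _ dz); rewrite in_setD_nbh zH nvz andbT.
  by apply/eqP => zv; have [_ _] := DE d dD; rewrite -zv zd.
have clZ : clique e Z.
  move=> z z' /ZE[_ _ vz nz] /ZE[_ _ vz' nz'] zz'.
  apply: (chordal_common_neighbors e_sym e_irr e_chordal conD _ _ vz vz' nz nz' zz').
    by apply/negP => /DE[]; rewrite eqxx.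
  by move=> d /DE[].
pose H1 := D :|: Z.
have H1H : H1 \subset H.
  by apply/subsetP => j; rewrite in_setU => /orP[/DE[]|/ZE[]].
have lt1 : (#|H1| < m)%N.
  rewrite -ltnS; apply: leq_trans ltH; rewrite ltnS; apply: proper_card.
  apply/properP; split=> //; exists v => //.
  by rewrite in_setU negb_or; apply/andP; split;
     [apply/negP => /DE[]; rewrite eqxx|apply/negP => /ZE[]; rewrite e_irr].
(* A vertex of [D] has all its [H]-neighbours in [H1], so being simplicial lifts from [H1] to
   [H]. *)
have up s : s \in D -> simplicial H1 s -> exists s, [/\ simplicial H s, s != v & ~~ e v s].
  move=> sD [_ cl]; exists s; have [sH sv nvs] := DE s sD; split=> //; split=> // x y.
  rewrite !inE => /andP[xH sx] /andP[yH sy].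
  have key z : z \in H -> e s z -> z \in H1 :&: neighbors e s.
    move=> zH sz; have [zD|zD] := boolP (z \in D).
      by rewrite in_setI in_setU zD /= inE sz.
    rewrite in_setI in_setU (negbTE zD) /= in_set in_setD zD zH inE sz andbT /=.
    by apply/exists_inP; exists s; rewrite // e_sym.
  by apply: cl; apply: key.
(* The recursive call starts from a vertex for which the simplicial vertex found must avoid [Z]. If
   no such start exists, [H1] is a clique and [u] itself is simplicial. *)
have [[z zZ [x xH1 zx]]|noz] := pselect
  (exists2 z, z \in Z & exists2 x, x \in H1 & (x != z) && ~~ e z x).
  case/andP: zx => xz nzx.
  have [|||||s [sS sz nzs]] := IH H1 z x => //; first by rewrite in_setU zZ orbT.
  apply: (up s) => //; have := sS.1; rewrite in_setU => /orP[//|sZ].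
  by have := clZ z s zZ sZ; rewrite eq_sym sz (negbTE nzs) => /(_ isT).
have [[x xD [x' x'D xx]]|nox] := pselect
  (exists2 x, x \in D & exists2 x', x' \in D & (x' != x) && ~~ e x x').
  case/andP: xx => xx' nxx.
  have [|||||s [sS sz nzs]] := IH H1 x x' => //; rewrite ?in_setU ?xD ?x'D //.
  apply: (up s) => //; have := sS.1; rewrite in_setU => /orP[//|sZ].
  case: noz; exists s => //; exists x; first by rewrite in_setU xD.
  by rewrite eq_sym sz e_sym.
apply: (up u) => //; split; first by rewrite in_setU uD.
move=> x y; rewrite in_setI => /andP[xH1 _]; rewrite in_setI => /andP[yH1 _] xy.
apply: contrapT => /negP nxy.
have [xZ|xZ] := boolP (x \in Z).
  by case: noz; exists x => //; exists y => //; rewrite eq_sym xy.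
have [yZ|yZ] := boolP (y \in Z).
  by case: noz; exists y => //; exists x => //; rewrite xy e_sym.
move: xH1 yH1; rewrite !in_setU (negbTE xZ) (negbTE yZ) !orbF => xD yD.
by case: nox; exists x => //; exists y => //; rewrite eq_sym xy.
Qed.

Lemma chordal_simplicial H : H != set0 -> exists s, simplicial H s.
Proof.
case/set0Pn => v vH.
have [[x xH [y yH /andP[yx nxy]]]|cl] :=
  pselect (exists2 x, x \in H & exists2 y, y \in H & (y != x) && ~~ e x y).
  by have [s [sS _ _]] := chordal_simplicial_far xH yH yx nxy; exists s.
exists v; split=> // x y; rewrite !in_setI => /andP[xH _] /andP[yH _] xy.
apply: contrapT => /negP nxy; apply: cl; exists x => //; exists y => //.
by rewrite eq_sym xy.
Qed.

(* The hypothesis on [F] says that no clique of [F] becomes unreachable when a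
   single vertex [k] is picked.  Picking in each component a vertex complete to
   its boundary keeps the boundary of every remaining component a clique. *)
Lemma chordal_transversal_rec J (F : {set 'I_n} -> Prop) X :
  (forall C, F C -> clique e C) ->
  (forall k C, k \in J -> F C ->
     exists2 c, c \in C & c \in J /\ ~~ e k c) ->
  X \subset J ->
  (forall D, cut_connected (e := e) D -> D \subset X ->
     {in J :\: X &, forall z z', (exists2 d, d \in D & e z d) ->
        (exists2 d, d \in D & e z' d) -> z != z' -> e z z'}) ->
  exists T, [/\ T \subset X, stable e T &
    forall C, F C -> (exists2 c, c \in C & c \in X) ->
    exists2 c, c \in C & c \in T].
Proof.
move=> clF starF; have [m] := ubnP #|X|; elim: m X => // m IH X ltX sXJ phiX.
have [->|[d0 d0X]] := set_0Vmem X.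
  exists set0; split; rewrite ?sub0set //; first by move=> x y; rewrite inE.
pose D := component e X d0.
have d0D : d0 \in D by apply: component_refl.
have sDX : D \subset X by apply: component_sub.
have conD : cut_connected (e := e) D by apply: component_connected.
have sDJ := subset_trans sDX sXJ.
have DX u v : u \in D -> e u v -> v \in X -> v \in D.
  by move=> uD uv vX; apply: component_closed uD vX uv.
pose Z := [set z in J :\: D | [exists d in D, e z d]].
have ZE z : z \in Z -> [/\ z \in J, z \notin D, z \in J :\: X & exists2 d, d \in D & e z d].
  rewrite in_set in_setD => /andP[/andP[zD zJ] /exists_inP[d dD zd]].
  split=> //; last by exists d.
  rewrite in_setD zJ andbT; apply: contra zD => zX; apply: (DX d) => //.
  by rewrite e_sym.
have [|||k kD kZ] := @chordal_complete_vertex D Z conD.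
- by apply/set0Pn; exists d0.
- by move=> z z' /ZE[_ _ zJX zd] /ZE[_ _ z'JX z'd]; apply: (phiX D).
- by move=> z /ZE[_ zD _ zd]; split.
(* The recursion treats what picking [k] leaves of its component, then the other components. *)
pose D' := D :\: closed_nbh e k.
have [|||T1 [sT1 stT1 hT1]] := IH D'.
- rewrite -ltnS; apply: leq_trans ltX; rewrite ltnS; apply: proper_card.
  apply/properP; split; first exact: subset_trans (subsetDl _ _) sDX.
  by exists k; [apply: (subsetP sDX)|rewrite in_setD_nbh eqxx andbF].
- exact: subset_trans (subsetDl _ _) sDJ.
- move=> D1 conD1 sD1 z z' /setDP[zJ zD'] /setDP[z'J z'D'] nz nz'.
  have D1E d : d \in D1 -> [/\ d \in D, d != k & ~~ e k d].
    by move/(subsetP sD1); rewrite in_setD_nbh => /and3P[].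
  (* Such a [y] either was discarded from [D] as a neighbour of [k] or lies in the boundary [Z], to
     which [k] is complete. Two of them are then joined by chordality. *)
  have bd y : y \in J -> ~~ (y \in D') -> (exists2 d, d \in D1 & e y d) -> e k y.
    move=> yJ yD' [d dD1 yd]; have [dD dk nkd] := D1E d dD1.
    have [yD|yD] := boolP (y \in D).
      move: yD'; rewrite in_setD_nbh yD /= negb_and !negbK => /orP[/eqP yk|//].
      by rewrite -yk yd in nkd.
    by apply: kZ; rewrite in_set in_setD yD yJ; apply/exists_inP; exists d.
  apply: (chordal_common_neighbors e_sym e_irr e_chordal conD1 (v := k)) => //.
  + by apply/negP => /D1E[_]; rewrite eqxx.
  + by move=> d /D1E[].
  + exact: bd.
  + exact: bd.
have [|||T2 [sT2 stT2 hT2]] := IH (X :\: D).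
- rewrite -ltnS; apply: leq_trans ltX; rewrite ltnS; apply: proper_card.
  apply/properP; split; first exact: subsetDl.
  by exists d0 => //; rewrite in_setD d0D.
- exact: subset_trans (subsetDl _ _) sXJ.
- move=> D1 conD1 sD1 z z' zJ z'J nz nz'.
  have out y : y \in J :\: (X :\: D) -> (exists2 d, d \in D1 & e y d) -> y \in J :\: X.
    rewrite !in_setD negb_and negbK => /andP[/orP[yD|yX] yJ] [d dD1 yd]; last by rewrite yX.
    have := subsetP sD1 d dD1; rewrite in_setD => /andP[dD dX].
    by rewrite (DX y) in dD.
  by apply: (phiX D1); rewrite ?out //; apply: subset_trans sD1 (subsetDl _ _).
have T1E x : x \in T1 -> [/\ x \in D, x != k & ~~ e k x].
  by move/(subsetP sT1); rewrite in_setD_nbh => /and3P[].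
have T2E x : x \in T2 -> x \in X /\ x \notin D.
  by move/(subsetP sT2); rewrite in_setD => /andP[].
have cross x y : x \in D -> y \in T2 -> ~~ e x y.
  by move=> xD /T2E[yX yD]; apply: contra yD => xy; apply: (DX x).
exists (k |: (T1 :|: T2)); split.
- apply/subsetP => x; rewrite !inE => /or3P[/eqP->|/T1E[xD _ _]|/T2E[]//];
    exact: (subsetP sDX).
- move=> x y; rewrite !inE => /or3P[/eqP->|xT|xT] /or3P[/eqP->|yT|yT].
  + by rewrite e_irr.
  + by case: (T1E y yT).
  + exact: cross.
  + by rewrite e_sym; case: (T1E x xT).
  + exact: stT1.
  + by apply: cross => //; case: (T1E x xT).
  + by rewrite e_sym; apply: cross.
  + by rewrite e_sym; apply: cross => //; case: (T1E y yT).
  + exact: stT2.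
- move=> C FC [c cC cX].
  have [[c' c'C c'X]|no2] := pselect (exists2 c, c \in C & c \in X :\: D).
    have [|x xC xT2] := hT2 C FC; first by exists c'.
    by exists x => //; rewrite !inE xT2 !orbT.
  have cD : c \in D.
    by apply: contrapT => /negP cD; apply: no2; exists c => //; rewrite in_setD cD.
  (* A vertex of [C] not adjacent to [k] cannot lie in the boundary [Z]; so it is [k] or survives in
     [D']. *)
  have [x xC [xJ nkx]] := starF k C (subsetP sDJ k kD) FC.
  have [xk|xk] := eqVneq x k; first by exists x => //; rewrite !inE xk eqxx.
  have xD : x \in D.
    apply: contrapT => /negP xD.
    have xc : x != c by apply: contraNneq xD => ->.
    case/negP: nkx; apply: kZ; rewrite in_set in_setD xD xJ; apply/exists_inP; exists c => //.
    exact: (clF C FC).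
  have [|x' x'C x'T1] := hT1 C FC; first by exists x; rewrite // in_setD_nbh xD xk nkx.
  by exists x' => //; rewrite !inE x'T1 !orbT.
Qed.

(** With [X = J] no vertex of [J] lies outside [X], so the boundary condition holds vacuously. *)
Lemma chordal_transversal J (F : {set 'I_n} -> Prop) :
  (forall C, F C -> clique e C) ->
  (forall C, F C -> exists2 c, c \in C & c \in J) ->
  (forall k C, k \in J -> F C ->
     exists2 c, c \in C & c \in J /\ ~~ e k c) ->
  exists T, [/\ T \subset J, stable e T &
    forall C, F C -> exists2 c, c \in C & c \in T].
Proof.
move=> clF meetJ starF.
have [||T [sT stT hT]] := chordal_transversal_rec clF starF (X := J) => //.
  by move=> D _ _ z z'; rewrite setDv inE.
by exists T; split=> // C FC; apply: hT => //; apply: meetJ.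
Qed.

End Chordal.

(** * Clique covers and tight cliques *)

Section Covers.
Context {R : realType} {n : nat}.
Implicit Types (e : rel 'I_n) (w u : 'cV[R]_n) (y : {set 'I_n} -> R).
Implicit Types (C S T : {set 'I_n}) (i j : 'I_n).

Definition indicator S : 'cV[R]_n := \col_i (i \in S)%:R.

(** The cover is exact: the equality in the last clause becomes the diagonal constraint of
    (SDP-D). *)
Definition clique_cover e w y : Prop :=
  [/\ forall C, 0 <= y C, forall C, y C != 0 -> clique e C
    & forall i, w i 0 = \sum_(C : {set 'I_n} | i \in C) y C].

Definition tight e w C : Prop :=
  clique e C /\ forall T, mwss e w T -> exists2 i, i \in C & i \in T.

Definition has_tight_cliques e : Prop :=
  forall w, (forall i, 0 <= w i 0) -> (exists i, 0 < w i 0) ->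
  exists C, tight e w C.

(* The linear programming form of perfection. *)
Definition clique_perfect e : Prop :=
  forall w, (forall i, 0 <= w i 0) ->
  exists y T, [/\ clique_cover e w y, stable e T & \sum_(C : {set 'I_n}) y C = weight w T].

Lemma stable0 e : stable e set0.
Proof. by move=> i j; rewrite inE. Qed.

Lemma stableS e S T : S \subset T -> stable e T -> stable e S.
Proof. by move=> /subsetP sST stT i j iS jS; apply: stT; apply: sST. Qed.

Lemma cliqueS e S T : S \subset T -> clique e T -> clique e S.
Proof. by move=> /subsetP sST clT i j iS jS; apply: clT; apply: sST. Qed.

Lemma mwss_exists e w : exists T, mwss e w T.
Proof.
have := @arg_maxP _ R _ (set0 : {set 'I_n})
  (fun T => `[< stable e T >]) (weight w) (asboolT (@stable0 e)).
case=> T /asboolP stT maxT; exists T; split=> // S stS.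
by apply: maxT; apply/asboolP.
Qed.

Lemma card_clique_stable e C T : clique e C -> stable e T -> (#|T :&: C| <= 1)%N.
Proof.
move=> clC stT; apply/card_le1P => i; rewrite inE => /andP[iT iC] j.
rewrite !inE; apply/idP/idP => [/andP[jT jC]|/eqP->]; last by rewrite iT.
apply: contrapT => /negP ji; have := stT j i jT iT.
by rewrite clC.
Qed.

Lemma weightS w S T : (forall i, 0 <= w i 0) -> S \subset T -> weight w S <= weight w T.
Proof.
by move=> w0 sST; rewrite /weight [leRHS](big_setID S) /= (setIidPr sST) lerDl sumr_ge0.
Qed.

Lemma weight_support w S : (forall i, 0 <= w i 0) ->
  weight w (S :&: [set i | 0 < w i 0]) = weight w S.
Proof.
move=> w0; rewrite /weight [RHS](big_setID [set i | 0 < w i 0]) /=.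
rewrite [X in _ = _ + X]big1 ?addr0 // => i.
rewrite !inE -leNgt => /andP[wi _].
by apply/eqP; rewrite eq_le wi w0.
Qed.

Lemma weightU w S T : [disjoint S & T] -> weight w (S :|: T) = weight w S + weight w T.
Proof.
move=> dST; rewrite /weight -bigU //; apply: eq_bigl => i.
by rewrite !inE.
Qed.

Lemma weight_sub_indicator w a C S :
  weight (w - a *: indicator C) S = weight w S - a * #|S :&: C|%:R.
Proof.
rewrite /weight -sum1_card natr_sum mulr_sumr -sumrN.
under eq_bigr do rewrite !mxE; rewrite sumrB; congr (_ + _).
rewrite -sumrN [RHS](eq_bigl (fun i => (i \in S) && (i \in C))); last by move=> i; rewrite inE.
rewrite big_mkcondr /=; apply: eq_bigr => i _.
by case: (i \in C); rewrite ?mulr0 ?oppr0.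
Qed.

Lemma cover_weight e w y S : clique_cover e w y ->
  weight w S = \sum_(C : {set 'I_n}) y C * #|S :&: C|%:R.
Proof.
case=> _ _ yw; rewrite /weight (eq_bigr _ (fun i _ => yw i)).
rewrite (exchange_big_dep predT) //=; apply: eq_bigr => C _.
by rewrite sumr_const mulr_natr; congr (_ *+ _); apply: eq_card => i; rewrite !inE.
Qed.

Lemma cover_bound e w y T : clique_cover e w y -> stable e T ->
  weight w T <= \sum_(C : {set 'I_n}) y C.
Proof.
move=> yw stT; rewrite (cover_weight T yw); have [y0 ycl _] := yw.
apply: ler_sum => C _; have [->|yC] := eqVneq (y C) 0; first by rewrite mul0r.
rewrite ler_piMr // -[1]/(1%:R) ler_nat.
by apply: card_clique_stable stT; apply: ycl.
Qed.

(** Complementary slackness: a stable set missing [C] falls short of the cover bound by at least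
    [y C]. *)
Lemma cover_tight e w y T C : clique_cover e w y -> stable e T ->
  \sum_(C : {set 'I_n}) y C = weight w T -> y C != 0 -> tight e w C.
Proof.
move=> yw stT yT yC; have [y0 ycl _] := yw; split; first exact: ycl.
move=> T' [stT' maxT']; have [i|noi] := pselect (exists i, i \in T' :&: C).
  by case: i => i; rewrite inE => /andP[iT' iC]; exists i.
have : weight w T <= weight w T' by apply: maxT'.
rewrite -yT (cover_weight T' yw) leNgt => /negP[].
rewrite (bigD1 C) //= [ltRHS](bigD1 C) //=.
have -> : T' :&: C = set0.
  by apply/eqP; apply: contrapT => /negP/set0Pn[i iTC]; apply: noi; exists i.
rewrite cards0 mulr0 ltr_leD ?lt0r ?yC ?y0 //; apply: ler_sum => D _.
have [->|yD] := eqVneq (y D) 0; first by rewrite mul0r.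
rewrite ler_piMr // -[1]/(1%:R) ler_nat.
by apply: card_clique_stable stT'; apply: ycl.
Qed.

(** A stable set meeting every clique of positive weight in an optimal cover weighs at least the
    cost of that cover. *)
Lemma transversal_mwss e w S : clique_perfect e -> (forall i, 0 <= w i 0) ->
  stable e S -> (forall C, tight e w C -> exists2 i, i \in C & i \in S) ->
  mwss e w S.
Proof.
move=> perf w0 stS meetS; have [y [T [yw stT yT]]] := perf w w0.
split=> // T' stT'; apply: le_trans (cover_bound yw stT') _.
rewrite (cover_weight S yw); apply: ler_sum => C _.
have [->|yC] := eqVneq (y C) 0; first by rewrite mul0r.
have [y0 _ _] := yw; rewrite ler_peMr // -[1]/(1%:R) ler_nat card_gt0.
have [i iC iS] := meetS C (cover_tight yw stT yT yC).
by apply/set0Pn; exists i; rewrite inE iS.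
Qed.

(* The largest multiple of a tight clique that can be subtracted from [w]
   while the optimum drops at the same rate. *)
Lemma tight_reduction e w C T0 : tight e w C -> {in C, forall i, 0 < w i 0} ->
  mwss e w T0 ->
  exists a, [/\ 0 < a, {in C, forall i, a <= w i 0},
    forall T, stable e T ->
      weight (w - a *: indicator C) T <= weight w T0 - a
  & (exists2 i, i \in C & w i 0 = a) \/
    (exists T, [/\ stable e T, ~ mwss e w T &
       weight (w - a *: indicator C) T = weight w T0 - a])].
Proof.
move=> [clC tC] Cpos mT0; have [i0 i0C _] := tC T0 mT0.
have [stT0 maxT0] := mT0.
case: (@arg_minP _ R _ i0 (fun i => i \in C) (fun i => w i 0) i0C) => i1 i1C min1.
pose P T := `[< stable e T >] && (T :&: C == set0).
have P0 : P set0 by rewrite /P set0I eqxx andbT; apply/asboolP/stable0.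
case: (@arg_maxP _ R _ set0 P (weight w) P0) => T1 /andP[/asboolP stT1 /eqP T1C] max1.
have nT1 : ~ mwss e w T1.
  by move=> /tC[i iC iT1]; have := in_set0 i; rewrite -T1C inE iT1 iC.
have ltT1 : weight w T1 < weight w T0.
  rewrite ltNge; apply/negP => le01; apply: nT1; split=> // T stT.
  by apply: le_trans le01; apply: maxT0.
(* The subtraction stops when a vertex of [C] reaches weight zero or when a stable set missing [C]
   becomes maximum. *)
exists (Num.min (w i1 0) (weight w T0 - weight w T1)); set a := Num.min _ _.
have a1 : a <= w i1 0 by rewrite ge_min lexx.
have a2 : a <= weight w T0 - weight w T1 by rewrite ge_min lexx orbT.
split.
- by rewrite lt_min Cpos // subr_gt0.
- by move=> i iC; apply: le_trans a1 _; apply: min1.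
- move=> T stT; rewrite weight_sub_indicator.
  have [TC|TC] := eqVneq (T :&: C) set0.
    rewrite TC cards0 mulr0 subr0.
    have : weight w T <= weight w T1.
      by apply: max1; rewrite /P TC eqxx andbT; apply/asboolP.
    by move: a2; lra.
  have -> : #|T :&: C| = 1%N.
    by apply/eqP; rewrite eqn_leq (card_clique_stable clC stT) card_gt0.
  by rewrite mulr1 lerD2r maxT0.
- have [lt|ge] := leP (w i1 0) (weight w T0 - weight w T1).
    by left; exists i1 => //; rewrite /a min_l.
  right; exists T1; split=> //.
  rewrite weight_sub_indicator T1C cards0 mulr0 subr0 /a min_r; last exact: ltW.
  by rewrite opprB addrC subrK.
Qed.

Lemma cover_add e w y a C : 0 <= a -> clique e C ->
  clique_cover e (w - a *: indicator C) y ->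
  clique_cover e w (fun D => y D + a *+ (D == C)).
Proof.
move=> a0 clC [y0 ycl yw]; split.
- by move=> D; rewrite addr_ge0 // mulrn_wge0.
- move=> D; have [->//|_] := eqVneq D C; rewrite mulr0n addr0; exact: ycl.
- move=> i; rewrite big_split /= -yw !mxE.
  have -> : \sum_(D : {set 'I_n} | i \in D) a *+ (D == C) = a * (i \in C)%:R.
    rewrite big_mkcond /= (bigD1 C) //= eqxx big1 => [|D /negbTE->].
      by case: (i \in C); rewrite ?mulr1 ?mulr0 addr0.
    by case: ifP.
  by rewrite subrK.
Qed.

Lemma sum_cover_add y a C :
  \sum_D (y D + a *+ (D == C)) = \sum_D y D + a.
Proof.
rewrite big_split /=; congr (_ + _).
by rewrite (bigD1 C) //= eqxx big1 ?addr0 // => D /negbTE->.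
Qed.

(** Dropping zero-weight vertices keeps a stable set maximum. The restriction provides the
    positivity on the clique that [tight_reduction] requires. *)
Lemma tight_restrict e w C : (forall i, 0 <= w i 0) -> tight e w C ->
  tight e w (C :&: [set i | 0 < w i 0]).
Proof.
move=> w0 [clC tC]; split; first exact: cliqueS (subsetIl _ _) clC.
move=> T mT; have [stT maxT] := mT.
have [|i iC] := tC (T :&: [set i | 0 < w i 0]).
  split; first exact: stableS (subsetIl _ _) stT.
  by move=> S stS; rewrite weight_support // maxT.
by rewrite in_setI => /andP[iT iw]; exists i; rewrite // in_setI iC.
Qed.

(** Subtract multiples of tight cliques until the weight vanishes. Each subtraction shrinks the
    support or the family of non-maximum stable sets, and enlarges neither. *)
Lemma clique_perfect_tight e : has_tight_cliques e -> clique_perfect e.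
Proof.
move=> tightP w.
pose supp w := [set i | 0 < w i 0].
pose slackS w := [set T | `[< stable e T /\ ~ mwss e w T >]].
have [m] := ubnP (#|supp w| + #|slackS w|); elim: m w => // m IH w ltm w0.
have [[i wi]|now] := pselect (exists i, 0 < w i 0); last first.
  have wE i : w i 0 = 0.
    apply/eqP; rewrite eq_le w0 andbT leNgt; apply/negP => wi.
    by apply: now; exists i.
  exists (fun=> 0), set0; split; [split=> //| exact: stable0|].
  - by move=> C; rewrite eqxx.
  - by move=> i; rewrite big1.
  - by rewrite big1 // /weight big_set0.
have [C0 tC0] := tightP w w0 (ex_intro _ i wi).
have := tight_restrict w0 tC0; set C := C0 :&: _ => tC.
have Cpos : {in C, forall i, 0 < w i 0} by move=> j; rewrite !inE => /andP[].
have [T0 mT0] := mwss_exists e w; have [stT0 maxT0] := mT0.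
have [a [a0 aC aw alt]] := tight_reduction tC Cpos mT0.
pose w' := w - a *: indicator C.
have w'E j : w' j 0 = if j \in C then w j 0 - a else w j 0.
  by rewrite !mxE; case: ifP; rewrite ?mulr1 ?mulr0 ?subr0.
have w'0 j : 0 <= w' j 0 by rewrite w'E; case: ifP => // jC; rewrite subr_ge0 aC.
(* A maximum stable set meets the tight clique exactly once. *)
have w'mwss T : mwss e w T -> weight w' T = weight w T0 - a.
  move=> mT; have [stT maxT] := mT; rewrite weight_sub_indicator.
  have -> : #|T :&: C| = 1%N.
    apply/eqP; rewrite eqn_leq (card_clique_stable tC.1 stT) card_gt0.
    by have [j jC jT] := tC.2 T mT; apply/set0Pn; exists j; rewrite inE jT.
  by rewrite mulr1; congr (_ - _); apply/eqP; rewrite eq_le maxT // maxT0.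
have w'opt T : mwss e w T -> mwss e w' T.
  by move=> mT; split; [case: mT|move=> S stS; rewrite (w'mwss T mT) aw].
have s1 : supp w' \subset supp w.
  apply/subsetP => j; rewrite !in_set w'E; case: ifP => // _.
  by move=> /lt_trans; apply; rewrite ltrBlDr ltrDl.
have s2 : slackS w' \subset slackS w.
  apply/subsetP => T; rewrite !in_set => /asboolP[stT nT]; apply/asboolP.
  by split=> // mT; apply: nT; apply: w'opt.
have [||y [T' [yw' stT' yT']]] := IH w' => //.
  rewrite -ltnS; apply: leq_trans ltm; rewrite ltnS.
  case: alt => [[j jC wj]|[T [stT nmT wT]]].
    rewrite -addSn leq_add //; last exact: subset_leq_card.
    apply: proper_card; apply/properP; split=> //; exists j; rewrite in_set ?Cpos //.
    by rewrite w'E jC wj subrr ltxx.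
  rewrite -addnS leq_add //; first exact: subset_leq_card.
  apply: proper_card; apply/properP; split=> //; exists T; rewrite in_set.
    by apply/asboolP.
  apply/asboolP => -[_]; apply; split=> // S stS.
  by rewrite -/w' in wT; rewrite wT aw.
exists (fun D => y D + a *+ (D == C)), T0; split=> //.
  by apply: cover_add; [exact: ltW|exact: tC.1|].
have h1 : weight w' T' <= weight w T0 - a := aw T' stT'.
have h2 : weight w T0 - a <= weight w' T'.
  by rewrite -(w'mwss T0 mT0) -yT'; apply: cover_bound yw' stT0.
by rewrite sum_cover_add yT'; apply/eqP; rewrite eq_le; apply/andP; split; lra.
Qed.

(** An arbitrary optimal cover might give [C] weight zero. Removing a positive multiple of [C] first
    and covering the rest forces [0 < y C]. *)
Lemma tight_cover e w C : clique_perfect e -> (forall i, 0 < w i 0) ->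
  tight e w C -> exists y T,
  [/\ clique_cover e w y, stable e T, \sum_(C : {set 'I_n}) y C = weight w T & 0 < y C].
Proof.
move=> perf w0 tC; have [T0 mT0] := mwss_exists e w.
have [a [a0 aC aw _]] := tight_reduction tC (fun i _ => w0 i) mT0.
have [|y [T [yw stT yT]]] := perf (w - a *: indicator C).
  move=> i; rewrite !mxE; case: (boolP (i \in C)) => iC.
    by rewrite mulr1 subr_ge0 aC.
  by rewrite mulr0 subr0 ltW.
have cov := cover_add (ltW a0) tC.1 yw.
exists (fun D => y D + a *+ (D == C)), T0; split=> //.
- by case: mT0.
- apply/eqP; rewrite eq_le; apply/andP; split; last first.
    by apply: cover_bound cov _; case: mT0.
  by rewrite sum_cover_add yT -lerBrDr aw.
- by rewrite eqxx mulr1n; have [y0 _ _] := yw; rewrite ltr_wpDl.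
Qed.

(* Were no stable set of [e] to meet all maximum cliques, pick a maximum clique
   missing each stable set and cover the sum of their indicators: the cover
   would be too cheap. *)
Lemma complement_tight e : irreflexive e -> clique_perfect e ->
  has_tight_cliques (complement e).
Proof.
move=> e_irr perf u u0 [i ui].
have stC C : stable (complement e) C -> clique e C.
  by move=> st x y xC yC xy; have := st x y xC yC; rewrite /complement xy negbK.
have clC C : clique e C -> stable (complement e) C.
  move=> cl x y xC yC; rewrite /complement negb_and negbK; case: (eqVneq x y) => //= xy.
  by rewrite negbK cl.
have clS T : stable e T -> clique (complement e) T.
  by move=> st x y xT yT xy; rewrite /complement xy st.
apply: contrapT => notight.
have [|c cP] := @choice _ _ (fun T C : {set 'I_n} =>
    mwss (complement e) u C /\ (stable e T -> C :&: T = set0)).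
  move=> T.
  have [stT|nstT] := pselect (stable e T); last first.
    by have [C mC] := mwss_exists (complement e) u; exists C.
  apply: contrapT => noC; apply: notight; exists T; split; first exact: clS.
  move=> C mC; apply: contrapT => noi; apply: noC; exists C; split=> // _.
  apply/eqP; apply: contrapT => /negP/set0Pn[j]; rewrite inE => /andP[jC jT].
  by apply: noi; exists j.
pose St := [set T | `[< stable e T >]].
have StP T : T \in St -> stable e T by rewrite in_set => /asboolP.
pose w : 'cV[R]_n := \sum_(T in St) indicator (c T).
have wE j : w j 0 = \sum_(T in St) (j \in c T)%:R.
  by rewrite summxE; apply: eq_bigr => T _; rewrite mxE.
have [|y [T0 [yw stT0 yT0]]] := perf w.
  by move=> j; rewrite wE sumr_ge0.
have T0St : T0 \in St by rewrite in_set; apply/asboolP.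
pose M := weight u (c set0).
have uc T : weight u (c T) = M.
  have [[st1 m1] _] := cP T; have [[st2 m2] _] := cP set0.
  by apply/eqP; rewrite eq_le m1 // m2.
have M0 : 0 < M.
  have [[_ max0] _] := cP set0; apply: lt_le_trans ui _.
  have -> : u i 0 = weight u [set i] by rewrite /weight big_set1.
  apply: max0; apply: clC => x y'; rewrite !inE => /eqP-> /eqP->.
  by rewrite eqxx.
(* [T0] misses [c T0] and meets every other chosen clique at most once. *)
have small : weight w T0 <= #|St|%:R - 1.
  have -> : weight w T0 = \sum_(T in St) #|T0 :&: c T|%:R.
    rewrite /weight (eq_bigr _ (fun i _ => wE i)) exchange_big /=.
    apply: eq_bigr => T _; rewrite -sum1_card natr_sum.
    rewrite [RHS](eq_bigl (fun i => (i \in T0) && (i \in c T))); last by move=> j; rewrite inE.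
    by rewrite big_mkcondr /=; apply: eq_bigr => j _; case: (j \in c T).
  rewrite (bigD1 T0) //= setIC (cP T0).2 // cards0 add0r.
  rewrite -sum1_card natr_sum [X in _ <= X - 1](bigD1 T0) //= addrAC subrr add0r.
  apply: ler_sum => T /andP[TSt _]; rewrite ler_nat.
  by apply: card_clique_stable stT0; apply: stC; case: (cP T) => -[].
(* The same sum is counted over the chosen cliques here, and over the cover in [big2]. *)
have big1 : \sum_i w i 0 * u i 0 = #|St|%:R * M.
  rewrite -sum1_card natr_sum mulr_suml.
  under eq_bigr do rewrite wE mulr_suml.
  rewrite exchange_big /=; apply: eq_bigr => T _; rewrite mul1r -(uc T) /weight.
  rewrite [RHS]big_mkcond /=; apply: eq_bigr => j _.
  by case: (j \in c T); rewrite ?mul1r ?mul0r.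
have big2 : \sum_i w i 0 * u i 0 <= (\sum_(C : {set 'I_n}) y C) * M.
  have [y0 ycl yE] := yw.
  under eq_bigr do rewrite yE mulr_suml.
  rewrite (exchange_big_dep predT) //= mulr_suml; apply: ler_sum => C _.
  rewrite -mulr_sumr; have [->|yC] := eqVneq (y C) 0; first by rewrite !mul0r.
  rewrite ler_wpM2l //; have [[_ max0] _] := cP set0.
  by apply: max0; apply: clC; apply: ycl.
have : #|St|%:R * M <= (#|St|%:R - 1) * M.
  rewrite -big1; apply: le_trans big2 _; rewrite yT0; apply: ler_wpM2r => //; exact: ltW.
by rewrite mulrBl mul1r; move: M0; lra.
Qed.

End Covers.

(** * Rounding condition in each graph class *)

Section GraphClasses.
Context {R : realType} {n : nat} {e : rel 'I_n}.
Context (e_sym : symmetric e) (e_irr : irreflexive e).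
Implicit Types (w : 'cV[R]_n) (A B C J K S T Z : {set 'I_n}) (i j k : 'I_n).

(** A simplicial vertex [s] of the support forms a tight clique with its neighbours there: a stable
    set missing this clique could be enlarged by [s]. *)
Lemma chordal_tight : chordal e -> has_tight_cliques (R := R) e.
Proof.
move=> che w w0 [i wi]; pose H := [set i | 0 < w i 0].
have [|s [sH cls]] := chordal_simplicial e_sym e_irr che (H := H).
  by apply/set0Pn; exists i; rewrite inE.
exists (s |: (H :&: neighbors e s)); split.
  move=> x y; rewrite !in_setU1 => /orP[/eqP->|xN] /orP[/eqP->|yN] xy.
  - by rewrite eqxx in xy.
  - by move: yN; rewrite !inE => /andP[].
  - by move: xN; rewrite !inE e_sym => /andP[].
  - exact: cls.
move=> T [stT maxT]; apply: contrapT => noi.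
have noN t : t \in T -> t \in H -> ~~ e s t.
  move=> tT tH; apply/negP => st; apply: noi.
  by exists t; rewrite // in_setU1 in_setI tH inE st orbT.
have sT : s \notin T by apply/negP => sT; apply: noi; exists s; rewrite // setU11.
have : weight w (s |: (T :&: H)) <= weight w T.
  apply: maxT => x y; rewrite !in_setU1 => /orP[/eqP->|xT] /orP[/eqP->|yT].
  - by rewrite e_irr.
  - by move: yT => /setIP[]; exact: noN.
  - by move: xT => /setIP[]; rewrite e_sym; exact: noN.
  - by move: xT yT => /setIP[xT _] /setIP[yT _]; apply: stT.
rewrite weightU; last by rewrite disjoints1 in_setI (negbTE sT).
rewrite weight_support // gerDr /weight big_set1 leNgt.
by move: sH; rewrite inE => ->.
Qed.

Definition level_clique w A b0 : {set 'I_n} :=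
  [set b in component e (~: A) b0 | w b0 0 <= w b 0] :|:
  [set a in A | [forall b in component e (~: A) b0, (w b0 0 <= w b 0) ==> e a b]].

Lemma in_level_clique w A b0 x : (x \in level_clique w A b0) =
  (x \in component e (~: A) b0) && (w b0 0 <= w x 0) ||
  (x \in A) && [forall b in component e (~: A) b0, (w b0 0 <= w b 0) ==> e x b].
Proof. by rewrite in_setU; congr (_ || _); apply: in_set. Qed.

(** A stable set missing the clique has in the component of [b0] at most a vertex lighter than [b0],
    and its possible vertex in [A] has a non-neighbour [b] in the component with [w b0 0 <= w b 0].
    Exchanging for [b] gains weight. *)
Lemma level_clique_tight w A b0 :
  clique e A -> {in ~: A, forall i, clique e (component e (~: A) i)} ->
  b0 \notin A -> 0 < w b0 0 -> tight e w (level_clique w A b0).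
Proof.
move=> clA clB b0A wb0; pose K := component e (~: A) b0.
have clK : clique e K by apply: clB; rewrite inE.
have b0K : b0 \in K by apply: component_refl; rewrite inE.
split.
  move=> x y; rewrite !in_level_clique.
  move=> /orP[/andP[xK wx]|/andP[xA /forall_inP xb]] /orP[/andP[yK wy]|/andP[yA /forall_inP yb]] xy.
  - exact: clK.
  - by rewrite e_sym; apply: (implyP (yb x xK)).
  - by apply: (implyP (xb y yK)).
  - exact: clA.
move=> T [stT maxT]; apply: contrapT => noi.
have [b [bK wb Tb]] : exists b, [/\ b \in K, w b0 0 <= w b 0 & {in T :&: A, forall a, ~~ e b a}].
  have [TA|[a]] := set_0Vmem (T :&: A); first by exists b0; split=> // a; rewrite TA inE.
  rewrite in_setI => /andP[aT aA].
  have /forall_inPn[b bK] : ~~ [forall b in K, (w b0 0 <= w b 0) ==> e a b].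
    apply/negP => aK; apply: noi; exists a => //.
    by rewrite in_level_clique aA aK orbT.
  rewrite negb_imply => /andP[wb nab]; exists b; split=> // a' /setIP[a'T a'A].
  have [->|aa'] := eqVneq a' a; first by rewrite e_sym.
  by have := stT a' a a'T aT; rewrite clA.
have bA : b \notin A by move/(subsetP (component_sub _ _)): bK; rewrite inE.
have : weight w (b |: (T :\: K)) <= weight w T.
  have nb t : t \in T :\: K -> ~~ e b t.
    move=> /setDP[tT tK]; have [tA|tA] := boolP (t \in A).
      by apply: Tb; rewrite inE tT.
    by apply: contra tK => bt; apply: (component_closed bK) => //; rewrite inE.
  apply: maxT => x y; rewrite !in_setU1 => /orP[/eqP->|xT] /orP[/eqP->|yT].
  - by rewrite e_irr.
  - exact: nb.
  - by rewrite e_sym; apply: nb.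
  - by move: xT yT => /setDP[xT _] /setDP[yT _]; apply: stT.
rewrite weightU; last by rewrite disjoints1 in_setD bK.
have -> : weight w T = weight w (T :&: K) + weight w (T :\: K) by apply: big_setID.
rewrite lerD2r {1}/weight big_set1 leNgt => /negP; apply.
have [TK|[b' b'TK]] := set_0Vmem (T :&: K).
  by rewrite TK /weight big_set0; apply: lt_le_trans wb.
have [b'T b'K] := setIP b'TK.
have -> : T :&: K = [set b'].
  apply/eqP; rewrite eq_sym eqEcard sub1set b'TK cards1.
  exact: card_clique_stable clK stT.
rewrite /weight big_set1; apply: lt_le_trans wb.
rewrite ltNge; apply/negP => wb'; apply: noi; exists b' => //.
by rewrite in_level_clique b'K wb'.
Qed.

Lemma unipolar_tight : unipolar e -> has_tight_cliques (R := R) e.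
Proof.
move=> [A [clA clB]] w w0 [i wi].
have [[b [bA wb]]|nob] := pselect (exists b, b \notin A /\ 0 < w b 0).
  by exists (level_clique w A b); apply: level_clique_tight.
exists A; split=> // T [stT maxT]; apply: contrapT => noi.
have : weight w [set i] <= weight w T.
  by apply: maxT => x y; rewrite !inE => /eqP-> /eqP->; rewrite e_irr.
have -> : weight w T = 0.
  apply: big1 => j jT; apply/eqP; rewrite eq_le w0 andbT leNgt; apply/negP => wj.
  apply: nob; exists j; split=> //; apply/negP => jA; apply: noi; exists j => //.
by rewrite /weight big_set1 leNgt wi.
Qed.

(* [J] is the set of vertices left and [S] the set of vertices already chosen. *)
Definition separated S J : Prop :=
  [/\ stable e S, [disjoint J & S] & {in S & J, forall s j, ~~ e s j}].

(** The trace left by a pruned state of full value. The second clause is the first one for the state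
    reached by selecting [k]. *)
Definition extendable w S J : Prop :=
  (forall C, tight e w C -> exists2 c, c \in C & (c \in S) || (c \in J)) /\
  (forall k C, k \in J -> tight e w C ->
     exists2 c, c \in C & (c \in S) || (c \in J) && ~~ e k c).

(** [Z] bounds the vertices still in play: it is the outcome of Phase I in part (a), and a bipartite
    part of the graph in part (b). *)
Definition rounds w Z : Prop :=
  forall S J, S :|: J \subset Z -> separated S J -> extendable w S J ->
  exists2 T : {set 'I_n}, T \subset J & mwss e w (T :|: S).

Lemma separated_stable S J T :
  separated S J -> T \subset J -> stable e T -> stable e (T :|: S).
Proof.
move=> [stS _ sep] /subsetP sTJ stT x y; rewrite !in_setU.
move=> /orP[xT|xS] /orP[yT|yS].
- exact: stT.
- by rewrite e_sym; apply: sep => //; apply: sTJ.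
- by apply: sep => //; apply: sTJ.
- exact: stS.
Qed.

Lemma rounds_transversal w Z : clique_perfect (R := R) e -> (forall i, 0 <= w i 0) ->
  (forall S J, S :|: J \subset Z -> separated S J -> extendable w S J ->
   exists T : {set 'I_n}, [/\ T \subset J, stable e T & forall C, tight e w C ->
     [disjoint C & S] -> exists2 c, c \in C & c \in T]) ->
  rounds w Z.
Proof.
move=> perf w0 H S J SJZ sep ext; have [T [sTJ stT hT]] := H S J SJZ sep ext.
exists T => //; apply: transversal_mwss => //; first exact: separated_stable sep sTJ stT.
move=> C tC; have [dCS|] := boolP [disjoint C & S].
  by have [c cC cT] := hT C tC dCS; exists c; rewrite // inE cT.
rewrite -setI_eq0 => /set0Pn[c /setIP[cC cS]].
by exists c; rewrite // inE cS orbT.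
Qed.

Lemma extendable_disjoint w S J C : extendable w S J -> tight e w C ->
  [disjoint C & S] -> (exists2 c, c \in C & c \in J) /\
  (forall k, k \in J -> exists2 c, c \in C & c \in J /\ ~~ e k c).
Proof.
move=> [ext1 ext2] tC dCS; split.
  have [c cC] := ext1 C tC; rewrite (disjointFr dCS cC) => cJ; by exists c.
move=> k kJ; have [c cC] := ext2 k C kJ tC.
by rewrite (disjointFr dCS cC) => /andP[cJ nkc]; exists c.
Qed.

Lemma chordal_rounds w Z : clique_perfect (R := R) e -> (forall i, 0 <= w i 0) ->
  chordal e -> rounds w Z.
Proof.
move=> perf w0 che; apply: rounds_transversal => // S J _ _ ext.
have [C [[clC _] _]|C [tC dC]|k C kJ [tC dC]|T [sT stT hT]] :=
  chordal_transversal e_sym e_irr che (J := J) (F := fun C => tight e w C /\ [disjoint C & S]).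
- exact: clC.
- by have [] := extendable_disjoint ext tC dC.
- by have [_] := extendable_disjoint ext tC dC; apply.
- by exists T; split=> // C tC dC; apply: hT.
Qed.

Lemma complement_sym : symmetric (complement e).
Proof. by move=> x y; rewrite /complement eq_sym e_sym. Qed.

Lemma complement_irr : irreflexive (complement e).
Proof. by move=> x; rewrite /complement eqxx. Qed.

(** For [s] simplicial in the complement on [J], the vertices of [J] not adjacent to [s] form a
    stable set, and [extendable] at [k = s] says that this set meets every tight clique missed by
    [S]. *)
Lemma cochordal_rounds w Z : clique_perfect (R := R) e -> (forall i, 0 <= w i 0) ->
  cochordal e -> rounds w Z.
Proof.
move=> perf w0 che; apply: rounds_transversal => // S J _ _ ext.
have [J0|Jn0] := eqVneq J set0.
  exists set0; split; [exact: sub0set|exact: stable0|] => C tC dC.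
  by have [[c _]] := extendable_disjoint ext tC dC; rewrite J0 inE.
have [s [sJ cls]] := chordal_simplicial complement_sym complement_irr che Jn0.
exists (J :\: neighbors e s); split; first exact: subsetDl.
  move=> x y /setDP[xJ]; rewrite inE => sx /setDP[yJ]; rewrite inE => sy.
  have [->|xy] := eqVneq x y; first by rewrite e_irr.
  have [xs|xs] := eqVneq s x; first by rewrite -xs.
  have [ys|ys] := eqVneq s y; first by rewrite -ys e_sym.
  have : complement e x y.
    by apply: cls; rewrite // !inE /complement ?xJ ?yJ ?xs ?ys ?sx ?sy.
  by rewrite /complement => /andP[].
move=> C tC dC; have [_ /(_ s sJ)[c cC [cJ nsc]]] := extendable_disjoint ext tC dC.
by exists c; rewrite // !inE nsc.
Qed.

(** Take [J :&: A] with the isolated vertices of [J]. A tight clique missing [S] and [J :&: A] has a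
    single vertex in [J], and [extendable] at every [k] makes that vertex isolated. *)
Lemma bipartite_rounds w A B : clique_perfect (R := R) e -> (forall i, 0 <= w i 0) ->
  stable e A -> stable e B -> rounds w (A :|: B).
Proof.
move=> perf w0 stA stB; apply: rounds_transversal => // S J SJ _ ext.
have JAB : {in J, forall j, j \notin A -> j \in B}.
  move=> j jJ jA; have := subsetP SJ j; rewrite !inE jJ orbT (negbTE jA); exact.
exists [set j in J | (j \in A) || [forall k in J, ~~ e j k]]; split.
- by apply/subsetP => j; rewrite inE => /andP[].
- move=> x y; rewrite !inE => /andP[xJ xT] /andP[yJ yT].
  case/orP: xT => [xA|/forall_inP ->//].
  case/orP: yT => [yA|/forall_inP yI]; last by rewrite e_sym yI.
  exact: stA.
move=> C tC dC; have [[c cC cJ] star] := extendable_disjoint ext tC dC.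
have [[a aC /andP[aJ aA]]|noA] := pselect (exists2 a, a \in C & (a \in J) && (a \in A)).
  by exists a; rewrite // inE aJ aA.
have one x : x \in C -> x \in J -> x = c.
  move=> xC xJ; apply: contrapT => /eqP xc.
  have inB z : z \in C -> z \in J -> z \in B.
    by move=> zC zJ; apply: JAB => //; apply/negP => zA; apply: noA; exists z; rewrite // zJ.
  have := stB x c (inB x xC xJ) (inB c cC cJ).
  by rewrite tC.1.
exists c; rewrite // inE cJ; apply/orP; right; apply/forall_inP => k kJ.
have [x xC [xJ]] := star k kJ; rewrite (one x) // e_sym.
done.
Qed.

(** No transversal is built: a maximum stable set [T0] is moved into the vertices in play, component
    by component, without losing weight. *)
Lemma unipolar_rounds w Z : clique_perfect (R := R) e -> (forall i, 0 < w i 0) ->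
  (forall i, i \in Z -> exists2 T, mwss e w T & i \in T) ->
  unipolar e -> rounds w Z.
Proof.
move=> perf w0 Zopt [A [clA clB]] S J SJZ sep ext.
have [stS dJS sepSJ] := sep.
suff [W [T0 [mT0 WSJ tW WA nW]]] : exists W T0 : {set 'I_n},
  [/\ mwss e w T0, W \subset S :|: J,
    forall C, tight e w C -> exists2 c, c \in C & c \in W,
    W :&: A = T0 :&: A & {in W :&: A & W, forall a c, ~~ e a c}].
  have [stT0 maxT0] := mT0.
  have [|phi phiP] := @choice _ _ (fun b c => b \in T0 ->
      c \in W /\ (if b \in A then c = b else
        c \in component e (~: A) b /\ w b 0 <= w c 0)).
    move=> b; have [bT0|] := boolP (b \in T0); last by exists b.
    have [bA|bA] := boolP (b \in A).
      exists b => _; split=> //.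
      by have : b \in T0 :&: A by [rewrite inE bT0|]; rewrite -WA => /setIP[].
    (* A [c] in [A] would be a vertex of [T0] complete to a level containing [b], against stability.
       So [c] lies in the component of [b] and is at least as heavy. *)
    have [c cC cW] := tW _ (level_clique_tight clA clB bA (w0 b)).
    exists c => _; split=> //; move: cC.
    rewrite in_level_clique => /orP[/andP[]//|/andP[cA /forall_inP cb]].
    have cT0 : c \in T0 :&: A by rewrite -WA inE cW.
    have [cT _] := setIP cT0.
    have := cb b (component_refl _); rewrite lexx inE bA => /(_ isT) /= ecb.
    by have := stT0 c b cT bT0; rewrite ecb.
  have phiW b : b \in T0 -> phi b \in W by move=> /phiP[].
  have phi_notA b : b \in T0 -> b \notin A -> phi b \notin A.
    move=> bT0 bA; have [_] := phiP b bT0; rewrite (negbTE bA) => -[+ _].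
    by move/(subsetP (component_sub _ _)); rewrite inE.
  have phiA b : b \in T0 -> b \in A -> phi b = b.
    by move=> bT0 bA; have [_] := phiP b bT0; rewrite bA.
  have phinadj b b' : b \in T0 -> b' \in T0 -> b != b' ->
      (phi b != phi b') && ~~ e (phi b) (phi b').
    move=> bT0 b'T0 bb'.
    have nbb' := stT0 b b' bT0 b'T0.
    have [bA|bA] := boolP (b \in A).
      have phib : phi b \in W :&: A by rewrite inE phiW // phiA.
      rewrite nW ?phiW // andbT; have [b'A|b'A] := boolP (b' \in A); first by rewrite !phiA.
      by apply: contraNneq (phi_notA b' b'T0 b'A) => <-; case/setIP: phib.
    have [b'A|b'A] := boolP (b' \in A).
      have phib : phi b' \in W :&: A by rewrite inE phiW // phiA.
      rewrite e_sym nW ?phiW // andbT.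
      by apply: contraNneq (phi_notA b bT0 bA) => ->; case/setIP: phib.
    have [_] := phiP b bT0; rewrite (negbTE bA) => -[cK _].
    have [_] := phiP b' b'T0; rewrite (negbTE b'A) => -[c'K _].
    have csym : connect_sym [rel u v | [&& u \in ~: A, v \in ~: A & e u v]].
      by apply: sym_connect_sym => u v; rewrite /= e_sym andbCA.
    have apart : phi b' \notin component e (~: A) b.
      apply: contra nbb' => c'Kb; have : b' \in component e (~: A) b.
        move: c'K c'Kb; rewrite !in_set b'A => /andP[_ +] /andP[_ bc'] /=.
        by rewrite csym; apply: connect_trans.
      move=> b'K; apply: (clB b) => //; first by rewrite inE.
      by apply: component_refl; rewrite inE.
    apply/andP; split; first by apply: contraNneq apart => <-.
    apply: contra apart => cc'; apply: component_closed cK _ cc'.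
    by rewrite inE phi_notA.
  pose T := phi @: T0.
  have sTW : T \subset W by apply/subsetP => _ /imsetP[b bT0 ->]; apply: phiW.
  have stT : stable e T.
    move=> _ _ /imsetP[b bT0 ->] /imsetP[b' b'T0 ->].
    have [->|bb'] := eqVneq b b'; first by rewrite e_irr.
    by have /andP[] := phinadj b b' bT0 b'T0 bb'.
  have wT : weight w T0 <= weight w T.
    rewrite /weight big_imset /=; last first.
      move=> b b' bT0 b'T0 phibb'; apply: contrapT => /eqP bb'.
      by have := phinadj b b' bT0 b'T0 bb'; rewrite phibb' eqxx.
    apply: ler_sum => b bT0; have [_] := phiP b bT0.
    by case: (b \in A) => [->|[]].
  have sTJ : T :\: S \subset J.
    apply/subsetP => x /setDP[/(subsetP sTW)/(subsetP WSJ)]; rewrite inE.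
    by case/orP => [->|].
  exists (T :\: S) => //; split.
    by apply: separated_stable sep sTJ _; apply: stableS stT; apply: subsetDl.
  move=> T' stT'; apply: le_trans (maxT0 T' stT') _; apply: le_trans wT _.
  apply: weightS => [i|]; first exact: ltW.
  by apply/subsetP => x xT; rewrite !inE xT andbT orNb.
(* If some [a] of [A] is in play, deleting its neighbours leaves it alone in [A]; [extendable] keeps
   all tight cliques met, and [T0] is chosen through [a]. *)
have [[a aSJ aA]|noa] := pselect (exists2 a, a \in S :|: J & a \in A).
  have [T0 mT0 aT0] := Zopt a (subsetP SJZ a aSJ).
  have Sa s : s \in S -> ~~ e a s.
    move=> sS; move: aSJ; rewrite inE => /orP[aS|aJ]; first exact: stS.
    by rewrite e_sym; apply: sepSJ.
  exists ((S :|: J) :\: neighbors e a), T0; split=> //.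
  - exact: subsetDl.
  - move=> C tC; move: (aSJ); rewrite in_setU => /orP[aS|aJ].
      have [c cC cSJ] := ext.1 C tC; exists c => //.
      rewrite !inE cSJ andbT; case/orP: cSJ => [/Sa//|cJ]; exact: sepSJ.
    have [c cC cSJ] := ext.2 a C aJ tC; exists c => //.
    by rewrite !inE; case/orP: cSJ => [cS|/andP[-> ->]]; rewrite ?cS ?Sa ?orbT.
  - have T0A : T0 :&: A = [set a].
      apply/eqP; rewrite eq_sym eqEcard sub1set in_setI aT0 aA cards1.
      by apply: card_clique_stable clA _; case: mT0.
    rewrite T0A; apply/setP => x; rewrite in_setI in_setD !inE.
    have [->|xa] := eqVneq x a; first by rewrite e_irr aA andbT; rewrite inE in aSJ.
    by case: (boolP (x \in A)) => [xA|]; rewrite ?andbF // clA // eq_sym.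
  - move=> x c /setIP[/setDP[xSJ]]; rewrite inE => nax xA /setDP[_]; rewrite inE.
    have [->//|xa] := eqVneq x a; by rewrite clA // eq_sym in nax.
have [[T0 mT0 T0A]|noT0] := pselect (exists2 T0, mwss e w T0 & T0 :&: A = set0).
  have SJA : (S :|: J) :&: A = set0.
    apply/eqP; apply: contrapT => /negP/set0Pn[a /setIP[aSJ aA]]; apply: noa; by exists a.
  exists (S :|: J), T0; split=> //.
  - by move=> C /ext.1[c cC cSJ]; exists c; rewrite // inE.
  - by rewrite SJA.
  - by move=> a c; rewrite SJA inE.
(* Every maximum stable set now meets [A], so [A] is tight and has a vertex in play, a
   contradiction. *)
have [|c cA cSJ] := ext.1 A; last by case: noa; exists c; rewrite // inE.
split=> // T mT; apply: contrapT => noi; apply: noT0; exists T => //.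
apply/eqP; apply: contrapT => /negP/set0Pn[i /setIP[iT iA]].
by apply: noi; exists i.
Qed.

End GraphClasses.

(** * The value function as a minimum *)

Section QuadraticForms.
Context {R : realType} {n : nat}.
Implicit Types (t a s : R) (q z : 'cV[R]_n) (Q : 'M[R]_n) (S T J : {set 'I_n}).

Definition energy q Q z : R := (z^T *m Q *m z) 0 0 + 2 * (q^T *m z) 0 0.

Definition supported z S : Prop := forall i, i \notin S -> z i 0 = 0.

Lemma mxform_sum Q (z1 z2 : 'cV[R]_n) :
  (z1^T *m Q *m z2) 0 0 = \sum_i \sum_j z1 i 0 * Q i j * z2 j 0.
Proof.
rewrite mxE exchange_big /=; apply: eq_bigr => j _; rewrite mxE mulr_suml.
by apply: eq_bigr => i _; rewrite mxE.
Qed.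

Lemma mxdot_sum m (q z : 'cV[R]_m) : (q^T *m z) 0 0 = \sum_i q i 0 * z i 0.
Proof. by rewrite mxE; apply: eq_bigr => i _; rewrite mxE. Qed.

Lemma mxdotC m (b u : 'cV[R]_m) : (u^T *m b) 0 0 = (b^T *m u) 0 0.
Proof. by rewrite !mxdot_sum; apply: eq_bigr => i _; rewrite mulrC. Qed.

Lemma energyD q Q (z1 z2 : 'cV[R]_n) : Q^T = Q ->
  energy q Q (z1 + z2) =
  energy q Q z1 + energy q Q z2 + 2 * (z1^T *m Q *m z2) 0 0.
Proof.
move=> QT; have sym : (z2^T *m Q *m z1) 0 0 = (z1^T *m Q *m z2) 0 0.
  by rewrite -mulmxA mxdotC trmx_mul QT.
rewrite /energy [(z1 + z2)^T]linearD /= !mulmxDl !mulmxDr.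
have mxD (A B : 'M[R]_1) : (A + B) 0 0 = A 0 0 + B 0 0 by rewrite mxE.
by rewrite !mxD sym; ring.
Qed.

Lemma energy_extrapolation a q0 q Q0 Q z :
  energy (q + a *: (q - q0)) (Q + a *: (Q - Q0)) z =
  energy q Q z + a * (energy q Q z - energy q0 Q0 z).
Proof.
have mxD (A B : 'M[R]_1) : (A + B) 0 0 = A 0 0 + B 0 0 by rewrite mxE.
have mxN (A : 'M[R]_1) : (- A) 0 0 = - A 0 0 by rewrite mxE.
have mxZ c (A : 'M[R]_1) : (c *: A) 0 0 = c * A 0 0 by rewrite mxE.
rewrite /energy; have -> : (q + a *: (q - q0))^T = q^T + a *: (q^T - q0^T).
  by rewrite linearD linearZ /= linearB.
rewrite !mulmxDl !mulmxDr !mulmxDl -!scalemxAr -!scalemxAl mulmxBl !mulmxBr mulmxBl.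
by rewrite !(mxD, mxZ, mxN); ring.
Qed.

Lemma psd_block_form t q Q s z :
  ((col_mx (s%:M : 'M[R]_1) z)^T *m block_mx t%:M q^T q Q *m col_mx s%:M z) 0 0 =
  t * s ^+ 2 + 2 * s * (q^T *m z) 0 0 + (z^T *m Q *m z) 0 0.
Proof.
have mxD (A B : 'M[R]_1) : (A + B) 0 0 = A 0 0 + B 0 0 by rewrite mxE.
have mxZ c (A : 'M[R]_1) : (c *: A) 0 0 = c * A 0 0 by rewrite mxE.
rewrite tr_col_mx tr_scalar_mx mul_row_block mul_row_col !mulmxDl.
rewrite !mul_scalar_mx !mul_mx_scalar -!scalemxAl !mxD !mxZ mxdotC.
by rewrite mxE eqxx mulr1n; ring.
Qed.

Lemma psd_energy t q Q z : psd (block_mx t%:M q^T q Q) -> - t <= energy q Q z.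
Proof.
move=> [_ /(_ (col_mx 1%:M z))]; rewrite psd_block_form /energy; lra.
Qed.

Lemma psd_block_drsub t q Q z : psd (block_mx t%:M q^T q Q) ->
  0 <= (z^T *m Q *m z) 0 0.
Proof.
by move=> [_ /(_ (col_mx 0%:M z))]; rewrite psd_block_form; lra.
Qed.

(** Along the line of [z] the energy is linear and bounded below by [- t]; the multiple of [z]
    chosen would give it the value [- (t + 1)]. *)
Lemma psd_block_ker t q Q z : psd (block_mx t%:M q^T q Q) ->
  (z^T *m Q *m z) 0 0 = 0 -> (q^T *m z) 0 0 = 0.
Proof.
move=> psdQ zQz; apply: contrapT => /eqP qz.
have := psd_energy (- (t + 1) / (2 * (q^T *m z) 0 0) *: z) psdQ.
have mxZ c (A : 'M[R]_1) : (c *: A) 0 0 = c * A 0 0 by rewrite mxE.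
rewrite /energy [(_ *: z)^T]linearZ /= -!scalemxAl -!scalemxAr !mxZ zQz !mulr0 add0r.
have -> : 2 * (- (t + 1) / (2 * (q^T *m z) 0 0) * (q^T *m z) 0 0) = - (t + 1).
  by field.
lra.
Qed.

(** The residual [u] lies in the kernel of [M], hence is orthogonal to [b] and to the range of [M],
    hence to itself. *)
Lemma mpinv_solve m (M : 'M[R]_m) (b : 'cV[R]_m) : M^T = M ->
  (forall u : 'cV[R]_m, M *m u = 0 -> (b^T *m u) 0 0 = 0) ->
  M *m (mpinv M *m b) = b.
Proof.
move=> MT kerb; have [MPM _ PT _] := mpinvP M.
set P := mpinv M in MPM PT *; pose u := b - M *m (P *m b).
have MMP : M *m (M *m P) = M by rewrite -{1}MT -PT -trmx_mul MPM MT.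
have Mu : M *m u = 0.
  by rewrite mulmxBr (mulmxA M P) (mulmxA M) MMP subrr.
have uu : (u^T *m u) 0 0 = 0.
  have bu := kerb u Mu.
  have PMu : (M *m P)^T *m u = 0 by rewrite trmx_mul MT -mulmxA Mu mulmx0.
  have -> : u^T = b^T - b^T *m (M *m P)^T.
    by rewrite /u [(_ - _)^T]linearB /= mulmxA (trmx_mul (M *m P)).
  by rewrite mulmxBl -mulmxA PMu mulmx0 subr0.
have u0 : u = 0.
  apply/colP => i; rewrite [RHS]mxE; move/eqP: uu; rewrite mxdot_sum psumr_eq0.
    by move=> /allP/(_ i (mem_index_enum _)); rewrite /= mulf_eq0 orbb => /eqP.
  by move=> j _; rewrite -expr2 sqr_ge0.
by apply/esym/eqP; rewrite -subr_eq0; apply/eqP.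
Qed.

End QuadraticForms.

Section ValueFunction.
Context {R : realType} {n : nat}.
Implicit Types (t a s : R) (q z : 'cV[R]_n) (Q : 'M[R]_n) (S T J : {set 'I_n}).

(** The matrix of extension by zero from the coordinates in [S]. *)
Definition inclusion S : 'M[R]_(n, #|S|) := colsub (@enum_val _ (mem S)) 1%:M.

Lemma inclusion_submat Q S : (inclusion S)^T *m Q *m inclusion S = submat Q S.
Proof.
rewrite /inclusion trmx_mxsub trmx1 mul_rowsub_mx mul1mx mulmx_colsub mulmx1.
by apply/matrixP => k l; rewrite !mxE.
Qed.

Lemma inclusion_subvec q S : (inclusion S)^T *m q = subvec q S.
Proof.
rewrite /inclusion trmx_mxsub trmx1 mul_rowsub_mx mul1mx.
by apply/colP => k; rewrite !mxE.
Qed.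

Lemma inclusion_supported S (u : 'cV[R]_#|S|) : supported (inclusion S *m u) S.
Proof.
move=> i iS; rewrite mxE big1 // => k _; rewrite !mxE.
have [ik|_] := eqVneq i (enum_val k); last by rewrite mul0r.
by rewrite ik (enum_valP k) in iS.
Qed.

Lemma supported_inclusion S z : supported z S -> z = inclusion S *m subvec z S.
Proof.
move=> zS; apply/colP => i; rewrite mxE.
have [iS|iS] := boolP (i \in S); last first.
  by rewrite (zS i iS); have := inclusion_supported (subvec z S) iS; rewrite mxE => ->.
rewrite (bigD1 (enum_rank_in iS i)) //= !mxE enum_rankK_in // eqxx mul1r.
rewrite big1 ?addr0 // => k ki; rewrite !mxE.
have [ik|_] := eqVneq i (enum_val k); last by rewrite mul0r.
by case/eqP: ki; apply: enum_val_inj; rewrite enum_rankK_in.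
Qed.

Lemma energy_inclusion q Q S (u : 'cV[R]_#|S|) :
  energy q Q (inclusion S *m u) =
  (u^T *m submat Q S *m u) 0 0 + 2 * ((subvec q S)^T *m u) 0 0.
Proof.
rewrite /energy -inclusion_submat -inclusion_subvec !trmx_mul trmxK.
by rewrite !mulmxA.
Qed.

(** Completing the square at [- y], where [y] solves [M *m y = b]. The equation is solvable because
    semidefiniteness makes [b] orthogonal to the kernel of [M]. *)
Lemma V_SDP_min t q Q S : psd (block_mx t%:M q^T q Q) -> Q^T = Q ->
  (exists z, supported z S /\ energy q Q z = - V_SDP q Q S) /\
  (forall z, supported z S -> - V_SDP q Q S <= energy q Q z).
Proof.
move=> psdQ QT; rewrite /V_SDP; case: eqVneq => [->|_].
  have e0 : energy q Q 0 = 0 by rewrite /energy !mulmx0 mxE; ring.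
  rewrite oppr0; split; first by exists 0; split=> // i _; rewrite mxE.
  move=> z z0; suff -> : z = 0 by rewrite e0.
  by apply/colP => i; rewrite z0 ?inE // mxE.
set M := submat Q S; set b := subvec q S.
have MT : M^T = M by apply/matrixP => k l; rewrite !mxE -[in LHS]QT mxE.
have psdM (u : 'cV[R]_#|S|) : 0 <= (u^T *m M *m u) 0 0.
  rewrite /M -inclusion_submat.
  by have := psd_block_drsub (inclusion S *m u) psdQ; rewrite trmx_mul !mulmxA.
have kerb (u : 'cV[R]_#|S|) : M *m u = 0 -> (b^T *m u) 0 0 = 0.
  move=> Mu; rewrite /b -inclusion_subvec trmx_mul trmxK -mulmxA.
  apply: (psd_block_ker psdQ).
  have -> : (inclusion S *m u)^T *m Q *m (inclusion S *m u) = u^T *m (M *m u).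
    by rewrite /M -inclusion_submat trmx_mul !mulmxA.
  by rewrite Mu mulmx0 mxE.
have Mb := mpinv_solve MT kerb; set y := mpinv M *m b in Mb.
have mxN (A : 'M[R]_1) : (- A) 0 0 = - A 0 0 by rewrite mxE.
have -> : (b^T *m mpinv M *m b) 0 0 = (b^T *m y) 0 0 by rewrite -mulmxA.
have yMy : (y^T *m M *m y) 0 0 = (b^T *m y) 0 0 by rewrite -mulmxA Mb mxdotC.
split.
  exists (inclusion S *m (- y)); split; first exact: inclusion_supported.
  rewrite energy_inclusion -/M -/b [(- y)^T]linearN /= !mulNmx !mulmxN opprK mxN yMy; ring.
move=> z /supported_inclusion ->; rewrite energy_inclusion -/M -/b.
set u := subvec z S.
have : energy b M (u + y) = energy b M u + energy b M y + 2 * (u^T *m M *m y) 0 0.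
  exact: energyD.
have -> : (u^T *m M *m y) 0 0 = (b^T *m u) 0 0 by rewrite -mulmxA Mb mxdotC.
rewrite /energy yMy; have := psdM (u + y).
have -> : (b^T *m (u + y)) 0 0 = (b^T *m u) 0 0 + (b^T *m y) 0 0 by rewrite mulmxDr mxE.
lra.
Qed.

End ValueFunction.

(** * Optimal solutions of the semidefinite programs *)

Section Semidefinite.
Context {R : realType} {n : nat} {e : rel 'I_n}.
Implicit Types (w q x z : 'cV[R]_n) (Q X : 'M[R]_n) (t a : R).
Implicit Types (y : {set 'I_n} -> R) (C S T J : {set 'I_n}).

(** Points slightly beyond [p] on the line from [p0] are affine combinations of [p0] and [p], and
    are close to [p]. *)
Lemma relative_interior_extrapolate (U : normedModType R) (D : set U) (p p0 : U) :
  relative_interior D p -> D p0 ->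
  exists2 a, 0 < a & D (p + a *: (p - p0)).
Proof.
move=> [Dp nearp] Dp0.
have lin : ((p + a *: (p - p0)) @[a --> (0 : R)] --> p)%classic.
  rewrite -[X in (_ --> X)%classic]addr0 -[X in (_ --> _ + X)%classic](scale0r (p - p0)).
  by apply: cvgD; [exact: cvg_cst|apply: cvgZr_tmp; exact: cvg_id].
have := lin _ nearp; rewrite /= => /nbhs_ballP[r /= r0 ball_r].
exists (r / 2); first by rewrite divr_gt0.
apply: ball_r.
  by rewrite /ball /= sub0r normrN gtr0_norm ?divr_gt0 // ltr_pdivrMr // ltr_pMr // ltr1n.
exists 2%N, (fun k => if k == ord0 then p else p0),
  (fun k => if k == ord0 then 1 + r / 2 else - (r / 2)).
split.
- by move=> k; case: ifP.
- by rewrite big_ord_recl big_ord1 /=; ring.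
- by rewrite big_ord_recl big_ord1 /= scalerBr scalerDl scale1r scaleNr addrA.
Qed.

Lemma block_mx_tr_dual t q Q : Q^T = Q ->
  (block_mx t%:M q^T q Q)^T = block_mx t%:M q^T q Q.
Proof. by move=> QT; rewrite tr_block_mx tr_scalar_mx trmxK QT. Qed.

Definition cover_matrix y : 'M[R]_n :=
  \matrix_(i, j) \sum_C y C * ((i \in C) && (j \in C))%:R.

Lemma cover_matrix_form y z :
  (z^T *m cover_matrix y *m z) 0 0 = \sum_C y C * weight z C ^+ 2.
Proof.
rewrite mxform_sum.
under eq_bigr => i _ do under eq_bigr => j _ do rewrite mxE mulr_sumr mulr_suml.
under eq_bigr => i _ do rewrite exchange_big /=.
rewrite exchange_big /=; apply: eq_bigr => C _.
rewrite expr2 /weight mulr_suml mulr_sumr [RHS]big_mkcond /=.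
apply: eq_bigr => i _; case: (boolP (i \in C)) => iC /=; last first.
  by rewrite big1 // => j _; rewrite !mulr0 mul0r.
rewrite mulr_sumr mulr_sumr [RHS]big_mkcond /=; apply: eq_bigr => j _.
by case: (j \in C); rewrite ?mulr1 ?mulr0 ?mul0r //; ring.
Qed.

Lemma cover_dot w y z : clique_cover e w y ->
  (w^T *m z) 0 0 = \sum_C y C * weight z C.
Proof.
move=> [_ _ yw]; rewrite mxdot_sum.
under eq_bigr do rewrite yw mulr_suml.
rewrite (exchange_big_dep predT) //=; apply: eq_bigr => C _.
by rewrite /weight mulr_sumr.
Qed.

(** A sum of squares that vanishes exactly when [weight z C = 1] for all cliques of positive
    weight. *)
Lemma cover_energy w y z : clique_cover e w y ->
  \sum_C y C + energy (- w) (cover_matrix y) z =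
  \sum_C y C * (1 - weight z C) ^+ 2.
Proof.
move=> yw; rewrite /energy cover_matrix_form [(- w)^T]linearN /= mulNmx mxE.
rewrite (cover_dot z yw) mulrN mulr_sumr -sumrN -!big_split /=.
by apply: eq_bigr => C _; ring.
Qed.

(* The block matrix of this solution is [\sum_C y_C (1, - 1_C)^T (1, - 1_C)]. *)
Lemma cover_dual_feasible w y : clique_cover e w y ->
  dual_feasible e w (\sum_C y C, - w, cover_matrix y).
Proof.
move=> yw; have [y0 ycl yE] := yw.
have QT : (cover_matrix y)^T = cover_matrix y.
  by apply/matrixP => i j; rewrite !mxE; apply: eq_bigr => C _; rewrite andbC.
split=> //.
- move=> i; rewrite !mxE yE.
  have -> : \sum_C y C * ((i \in C) && (i \in C))%:R = \sum_(C : {set 'I_n} | i \in C) y C.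
    rewrite [RHS]big_mkcond /=; apply: eq_bigr => C _; rewrite andbb.
    by case: (i \in C); rewrite ?mulr1 ?mulr0.
  ring.
- move=> i j ij nij; rewrite mxE big1 // => C _.
  have [->|yC] := eqVneq (y C) 0; first by rewrite mul0r.
  case: (boolP (i \in C)) => iC; last by rewrite mulr0.
  case: (boolP (j \in C)) => jC; last by rewrite mulr0.
  by rewrite (ycl C) in nij.
- split; first exact: block_mx_tr_dual.
  move=> v; rewrite -(vsubmxK v) [usubmx v]mx11_scalar psd_block_form.
  move: (usubmx v 0 0) (dsubmx v) => s z.
  rewrite cover_matrix_form [(- w)^T]linearN /= mulNmx mxE (cover_dot z yw).
  rewrite mulrN mulr_sumr -sumrN mulr_suml -!big_split /=.
  apply: sumr_ge0 => C _.
  suff -> : y C * s ^+ 2 - 2 * s * (y C * weight z C) + y C * weight z C ^+ 2 =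
    y C * (s - weight z C) ^+ 2 by rewrite mulr_ge0 // sqr_ge0.
  by ring.
Qed.

(** Only the diagonal of [Q] contributes on a stable set, and each diagonal term together with its
    linear term gives [- w i 0]. *)
Lemma stable_form w t q Q S : dual_feasible e w (t, q, Q) -> stable e S ->
  energy q Q (indicator S) = - weight w S.
Proof.
move=> [QT Qd Qoff _] stS; rewrite /energy mxform_sum mxdot_sum mulr_sumr -big_split /=.
rewrite /weight -sumrN [RHS]big_mkcond /=; apply: eq_bigr => i _.
case: (boolP (i \in S)) => iS; last first.
  rewrite big1 => [|j _]; first by rewrite mxE (negbTE iS) !mulr0 addr0.
  by rewrite mxE (negbTE iS) !mul0r.
rewrite (bigD1 i) //= big1 => [|j ji].
  by rewrite !mxE iS Qd /=; ring.
rewrite !mxE iS; case: (boolP (j \in S)) => jS; last by rewrite mulr0.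
by rewrite Qoff ?mul0r ?mulr0 ?mul0r // ?stS // eq_sym.
Qed.

Lemma separated_form w t q Q S J z : dual_feasible e w (t, q, Q) ->
  separated (e := e) S J -> supported z J ->
  energy q Q (indicator S + z) = energy q Q z - weight w S.
Proof.
move=> dQ [stS dJS sep] zJ; have [QT Qd Qoff _] := dQ.
rewrite energyD // (stable_form dQ stS).
suff -> : ((indicator S)^T *m Q *m z) 0 0 = 0 by ring.
rewrite mxform_sum big1 // => i _; rewrite big1 // => j _.
rewrite mxE; case: (boolP (i \in S)) => iS; last by rewrite !mul0r.
have [jJ|jJ] := boolP (j \in J); last by rewrite zJ // mulr0.
rewrite Qoff ?mulr0 ?mul0r //; last exact: sep.
by apply: contraTneq jJ => <-; rewrite (disjointFl dJS iS).
Qed.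

Lemma V_SDP_stable w t q Q S T : dual_feasible e w (t, q, Q) ->
  stable e T -> T \subset S -> weight w T <= V_SDP q Q S.
Proof.
move=> dQ stT /subsetP sTS; have [QT _ _ psdQ] := dQ.
have [_ /(_ (indicator T))] := V_SDP_min S psdQ QT.
rewrite (stable_form dQ stT) lerN2; apply.
by move=> i iS; rewrite mxE; case: (boolP (i \in T)) => // /sTS; rewrite (negbTE iS).
Qed.

(** The minimizer on [J], extended by the indicator of [S], is tested against the global lower bound
    [- t]. *)
Lemma V_SDP_separated w t q Q S J : dual_feasible e w (t, q, Q) ->
  separated (e := e) S J -> V_SDP q Q J + weight w S <= t.
Proof.
move=> dQ sep; have [QT _ _ psdQ] := dQ.
have [[z [zJ zV]] _] := V_SDP_min J psdQ QT.
have := psd_energy (indicator S + z) psdQ.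
rewrite (separated_form dQ sep zJ) zV; lra.
Qed.

Section DualOptimal.
Context {w : 'cV[R]_n} {t : R} {q : 'cV[R]_n} {Q : 'M[R]_n}.
Context (perf : clique_perfect (R := R) e) (w_pos : forall i, 0 < w i 0).
Context (opt : relative_interior (dual_optimal e w) (t, q, Q)).

Lemma relint_dual_feasible : dual_feasible e w (t, q, Q).
Proof. by have [[]] := opt. Qed.

Lemma dual_optimal_weight T : mwss e w T -> t = weight w T.
Proof.
move=> [stT maxT]; have [[feas min] _] := opt.
apply/eqP; rewrite eq_le; apply/andP; split.
  have [y [T' [yw stT' yT']]] := perf (fun i => ltW (w_pos i)).
  have := min _ (cover_dual_feasible yw); rewrite /= => /le_trans; apply.
  by rewrite yT' maxT.
have [_ _ _ psdQ] := feas; have := psd_energy (indicator T) psdQ.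
by rewrite (stable_form feas stT) lerN2.
Qed.

(** The dual solution can be pushed beyond [(t, q, Q)], away from a cover solution with [0 < y C].
    Since [z] already has energy [- t], semidefiniteness there forces the sum of squares of the
    cover to vanish at [z]. *)
Lemma dual_kernel z C : energy q Q z = - t -> tight e w C -> weight z C = 1.
Proof.
move=> zt tC; have [y [T [yw stT yT yC]]] := tight_cover perf w_pos tC.
have [_ maxT] : mwss e w T.
  by split=> // T' stT'; rewrite -yT; apply: cover_bound yw stT'.
have tT : t = weight w T by apply: dual_optimal_weight; split.
have opt0 : dual_optimal e w (\sum_C y C, - w, cover_matrix y).
  split; first exact: cover_dual_feasible.
  by move=> p'; have [[_ min] _] := opt; rewrite /= yT -tT; apply: min.
have [a a0 [feas _]] := relative_interior_extrapolate opt opt0.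
have [_ _ _ psdZ] := feas.
pose s0 := \sum_(D : {set 'I_n}) y D; pose e0 := energy (- w) (cover_matrix y) z.
have ineq : - (t + a * (t - s0)) <= energy q Q z + a * (energy q Q z - e0).
  by rewrite -energy_extrapolation; exact: psd_energy.
have : a * (s0 + e0) <= 0 by move: ineq; rewrite zt; lra.
rewrite pmulr_rle0 // cover_energy //.
have [y0 _ _] := yw.
have nneg D : true -> 0 <= y D * (1 - weight z D) ^+ 2 by rewrite mulr_ge0 ?sqr_ge0.
move=> le0; have : \sum_D y D * (1 - weight z D) ^+ 2 == 0.
  by rewrite eq_le le0 sumr_ge0.
rewrite psumr_eq0 // => /allP/(_ C (mem_index_enum _)) /=.
by rewrite mulf_eq0 gt_eqF //= sqrf_eq0 subr_eq0 eq_sym => /eqP.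
Qed.

(** The extended minimizer has energy [- t], so its entries on [C] sum to one and cannot all
    vanish. *)
Lemma separated_tight S J C : separated (e := e) S J -> t <= V_SDP q Q J + weight w S ->
  tight e w C -> exists2 c, c \in C & (c \in S) || (c \in J).
Proof.
move=> sep tV tC; have dQ := relint_dual_feasible; have [QT _ _ psdQ] := dQ.
have [[z [zJ zV]] _] := V_SDP_min J psdQ QT.
apply: contrapT => noc; have := oner_neq0 R; case/eqP.
rewrite -(@dual_kernel (indicator S + z) C) //.
  apply: big1 => c cC; rewrite !mxE.
  have [cS|cS] := boolP (c \in S); first by case: noc; exists c; rewrite // cS.
  have [cJ|cJ] := boolP (c \in J); first by case: noc; exists c; rewrite // cJ orbT.
  by rewrite zJ // addr0.
rewrite (separated_form dQ sep zJ) zV.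
by have := V_SDP_separated dQ sep; move: tV; lra.
Qed.

End DualOptimal.

Lemma stable_primal_feasible S : stable e S ->
  primal_feasible e (indicator (R := R) S, indicator S *m (indicator S)^T).
Proof.
move=> stS; split.
- by rewrite trmx_mul trmxK.
- move=> i; rewrite mxE big_ord1 !mxE.
  by case: (i \in S); rewrite ?mulr1 ?mulr0.
- move=> i j ij; rewrite mxE big_ord1 !mxE.
  case: (boolP (i \in S)) => iS; last by rewrite mul0r.
  case: (boolP (j \in S)) => jS; last by rewrite mulr0.
  by have := stS i j iS jS; rewrite ij.
- by rewrite subrr; split=> [|v]; rewrite ?trmx0 // mulmx0 mul0mx mxE.
Qed.

Lemma weight_indicator w S : (w^T *m indicator S) 0 0 = weight w S.
Proof.
rewrite mxdot_sum /weight [RHS]big_mkcond /=; apply: eq_bigr => i _; rewrite mxE.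
by case: (i \in S); rewrite ?mulr1 ?mulr0.
Qed.

(** Semidefiniteness is tested on the indicator of [C], where only the diagonal of [X]
    contributes. *)
Lemma primal_clique_le x X C : primal_feasible e (x, X) -> clique e C ->
  weight x C ^+ 2 <= weight x C.
Proof.
move=> [XT Xd X0 [_ /(_ (indicator C)) psdX]] clC; move: psdX.
rewrite mulmxBr mulmxBl mxE [X in _ + X]mxE subr_ge0.
have -> : ((indicator C)^T *m (x *m x^T) *m indicator C) 0 0 = weight x C ^+ 2.
  rewrite mulmxA -mulmxA mxE big_ord1 [X in X * _]mxdotC.
  by rewrite !weight_indicator expr2.
suff -> : ((indicator C)^T *m X *m indicator C) 0 0 = weight x C by [].
rewrite mxform_sum /weight [RHS]big_mkcond /=; apply: eq_bigr => i _.
case: (boolP (i \in C)) => iC; last by rewrite big1 // => j _; rewrite mxE (negbTE iC) !mul0r.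
rewrite (bigD1 i) //= !mxE iC Xd big1 => [|j ji]; first by rewrite /=; ring.
rewrite !mxE; case: (boolP (j \in C)) => jC; last by rewrite mulr0.
by rewrite X0 ?mulr0 ?mul0r // clC // eq_sym.
Qed.

Lemma primal_ge0 x X i : primal_feasible e (x, X) -> 0 <= x i 0.
Proof.
move=> feas; have := @primal_clique_le x X [set i] feas.
rewrite /weight big_set1 => xi; apply: le_trans (sqr_ge0 (x i 0)) _; apply: xi.
by move=> j k; rewrite !inE => /eqP-> /eqP->; rewrite eqxx.
Qed.

Lemma primal_clique1 x X C : primal_feasible e (x, X) -> clique e C -> weight x C <= 1.
Proof. by move=> feas clC; have := primal_clique_le feas clC; nra. Qed.

Lemma primal_cover w y x X : clique_cover e w y -> primal_feasible e (x, X) ->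
  (w^T *m x) 0 0 <= \sum_C y C.
Proof.
move=> yw feas; rewrite (cover_dot x yw); apply: ler_sum => C _.
have [y0 ycl _] := yw; have [->|yC] := eqVneq (y C) 0; first by rewrite mul0r.
by rewrite ler_piMr // (primal_clique1 feas) //; apply: ycl.
Qed.

Section PrimalOptimal.
Context {w x : 'cV[R]_n} {X : 'M[R]_n}.
Context (e_irr : irreflexive e) (perf : clique_perfect (R := R) e).
Context (w_pos : forall i, 0 < w i 0).
Context (opt : relative_interior (primal_optimal e w) (x, X)).

(** Extrapolating beyond [x], away from the indicator of [T], keeps coordinates nonnegative; a zero
    coordinate of [x] in [T] would become negative. *)
Lemma mwss_phase1 T : mwss e w T -> T \subset phase1 x.
Proof.
move=> [stT maxT]; apply/subsetP => i iT.
have [y [T' [yw stT' yT']]] := perf (fun i => ltW (w_pos i)).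
have optT : primal_optimal e w (indicator T, indicator T *m (indicator T)^T).
  split; first exact: stable_primal_feasible.
  move=> [x' X'] feas; rewrite weight_indicator; apply: le_trans (primal_cover yw feas) _.
  by rewrite yT' maxT.
have [a a0 [feas _]] := relative_interior_extrapolate opt optT.
have := primal_ge0 i feas; rewrite !mxE iT inE mulr1n => ge0.
rewrite ltNge; apply/negP => le0; move: ge0; rewrite leNgt => /negP; apply.
nra.
Qed.

(** Otherwise the weight of [i] could be raised by a gap [a] without raising the optimum, although
    the raised objective at [x] grows by [a * x i 0]. *)
Lemma phase1_mwss i : i \in phase1 x -> exists2 T, mwss e w T & i \in T.
Proof.
rewrite inE => xi; apply: contrapT => noT.
have [T0 [stT0 maxT0]] := mwss_exists e w.
pose P (T : {set 'I_n}) := `[< stable e T >] && (i \in T).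
have P1 : P [set i].
  rewrite /P set11 andbT; apply/asboolP => j k; rewrite !inE => /eqP-> /eqP->.
  by rewrite e_irr.
case: (@arg_maxP _ R _ [set i] P (weight w) P1) => T1 /andP[/asboolP stT1 iT1] max1.
pose a := weight w T0 - weight w T1.
have a0 : 0 < a.
  rewrite subr_gt0 ltNge; apply/negP => le01; apply: noT; exists T1 => //.
  by split=> // T stT; apply: le_trans le01; apply: maxT0.
(* The weight increase is written as a subtraction so that [weight_sub_indicator] applies. *)
have [|y [T [yw stT yT]]] := perf (w := w - (- a) *: indicator [set i]).
  move=> j; rewrite !mxE mulNr opprK addr_ge0 ?(ltW (w_pos j)) //.
  by rewrite mulr_ge0 ?ler0n // ltW.
have le1 : \sum_C y C <= weight w T0.
  rewrite yT weight_sub_indicator mulNr opprK.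
  have [iT|iT] := boolP (i \in T).
    have : weight w T <= weight w T1 by apply: max1; rewrite /P iT andbT; apply/asboolP.
    have -> : T :&: [set i] = [set i] by apply/setIidPr; rewrite sub1set.
    by rewrite cards1 mulr1 /a; lra.
  have -> : T :&: [set i] = set0 by apply/disjoint_setI0; rewrite disjoint_sym disjoints1.
  by rewrite cards0 mulr0 addr0 maxT0.
have [[feas max] _] := opt.
have := max _ (stable_primal_feasible stT0); rewrite weight_indicator /= => le2.
have := primal_cover yw feas; apply/negP; rewrite -ltNge.
have -> : ((w - (- a) *: indicator [set i])^T *m x) 0 0 = (w^T *m x) 0 0 + a * x i 0.
  have <- : ((indicator [set i])^T *m x) 0 0 = x i 0.
    by rewrite mxdotC weight_indicator /weight big_set1.
  rewrite scaleNr opprK [(w + _)^T]linearD /= [(a *: _)^T]linearZ /=.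
  rewrite mulmxDl -scalemxAl.
  have mxD (A B : 'M[R]_1) : (A + B) 0 0 = A 0 0 + B 0 0 by rewrite mxE.
  have mxZ c (A : 'M[R]_1) : (c *: A) 0 0 = c * A 0 0 by rewrite mxE.
  by rewrite mxD mxZ.
by apply: le_lt_trans le1 _; apply: le_lt_trans le2 _; rewrite ltrDl mulr_gt0.
Qed.

End PrimalOptimal.
End Semidefinite.

(** * The rounding algorithm *)

Section Algorithm.
Context {R : realType} {n : nat} {e : rel 'I_n}.
Context (e_sym : symmetric e) (e_irr : irreflexive e).
Context (perf : clique_perfect (R := R) e).
Context {w : 'cV[R]_n} {t : R} {q : 'cV[R]_n} {Q : 'M[R]_n}.
Context (w_pos : forall i, 0 < w i 0).
Context (opt : relative_interior (dual_optimal e w) (t, q, Q)).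
Implicit Types (I J S T Z : {set 'I_n}) (i j k : 'I_n).

Local Notation V := (V_SDP q Q).

Lemma prune_sub I J : prune e w V I J -> J \subset I.
Proof.
elim=> // {}I j {}J _ _ sJI; exact: subset_trans sJI (subD1set _ _).
Qed.

Lemma prune_stuck I J : prune e w V I J ->
  {in J, forall j, V J <= V (J :\: closed_nbh e j) + w j 0}.
Proof.
elim=> // {}I norem j jI; rewrite leNgt; apply/negP => gt; apply: (norem j).
by split=> //; rewrite ltrBrDl.
Qed.

Lemma separatedS S I J : J \subset I -> separated (e := e) S I -> separated (e := e) S J.
Proof.
move=> sJI [stS dIS sep]; split=> //; first exact: disjointWl dIS.
by move=> s j sS jJ; apply: sep => //; apply: (subsetP sJI).
Qed.

Lemma separated_select S I i : i \in I -> separated (e := e) S I ->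
  separated (e := e) (i |: S) (I :\: closed_nbh e i).
Proof.
move=> iI [stS dIS sep]; split.
- move=> x y; rewrite !in_setU1 => /orP[/eqP->|xS] /orP[/eqP->|yS].
  + by rewrite e_irr.
  + by rewrite e_sym sep.
  + exact: sep.
  + exact: stS.
- rewrite disjoint_sym disjoints_subset; apply/subsetP => x.
  rewrite in_setU1 inE in_setD_nbh => /orP[/eqP->|xS]; first by rewrite eqxx andbF.
  by rewrite (disjointFl dIS xS).
- move=> x y; rewrite in_setU1 in_setD_nbh => /orP[/eqP->|xS] /and3P[yI yi niy] //.
  exact: sep.
Qed.

Lemma weight_select S I i : i \in I -> separated (e := e) S I ->
  weight w (i |: S) = w i 0 + weight w S.
Proof.
move=> iI [_ dIS _]; rewrite weightU; first by rewrite {1}/weight big_set1.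
by rewrite disjoints1 (disjointFr dIS iI).
Qed.

(** As nothing is left to prune, selecting any [k] preserves the full value, so [separated_tight]
    applies before and after the selection. *)
Lemma separated_extendable S J : separated (e := e) S J -> t <= V J + weight w S ->
  {in J, forall k, V J <= V (J :\: closed_nbh e k) + w k 0} ->
  extendable (e := e) w S J.
Proof.
move=> sep tV stuck; split=> [C tC|k C kJ tC]; first exact: separated_tight sep tV tC.
have [|c cC] := separated_tight perf w_pos opt (separated_select kJ sep) _ tC.
  by rewrite (weight_select kJ sep) addrA; apply: le_trans tV _; rewrite lerD2r stuck.
move=> cP; exists c => //; move: cP.
rewrite in_setU1 in_setD_nbh -orbA => /or3P[/eqP->|->//|/and3P[-> _ ->]].
  by rewrite kJ e_irr orbT.
by rewrite orbT.
Qed.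

(** The invariant of Phase II. *)
Definition on_track S I : Prop :=
  separated (e := e) S I /\ exists2 T : {set 'I_n}, T \subset I & mwss e w (T :|: S).

Lemma weight_split S I T : separated (e := e) S I -> T \subset I ->
  weight w (T :|: S) = weight w T + weight w S.
Proof. by move=> [_ dIS _] sTI; rewrite weightU //; apply: disjointWl dIS. Qed.

(** Optimality of [T :|: S] gives [V I <= weight w T]. If [j] were in [T], then [T :\ j] would
    survive outside the neighbourhood of [j], and [V] would drop by at most [w j 0], against the
    pruning test. *)
Lemma on_track_prune S I J : prune e w V I J -> on_track S I -> on_track S J.
Proof.
elim=> // {}I j {}J [jI rem] _ IH [sep [T sTI mT]]; apply: IH.
split; first exact: separatedS (subD1set _ _) sep.
exists T => //; rewrite subsetD1 sTI; apply/negP => jT.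
have dQ := relint_dual_feasible opt.
have := V_SDP_separated dQ sep; rewrite (dual_optimal_weight perf w_pos opt mT).
rewrite (weight_split sep sTI) lerD2r => le1.
have stT : stable e T by apply: stableS mT.1; apply: subsetUl.
have := @V_SDP_stable _ _ _ w t q Q (I :\: closed_nbh e j) (T :\ j) dQ.
have -> : weight w (T :\ j) = weight w T - w j 0.
  by rewrite /weight [X in _ = X - _](big_setD1 j jT) /= addrAC subrr add0r.
move=> le2; have : weight w T - w j 0 <= V (I :\: closed_nbh e j).
  apply: le2; first exact: stableS (subD1set _ _) stT.
  apply/subsetP => x; rewrite in_setD1 in_setD_nbh => /andP[-> xT].
  by rewrite (subsetP sTI) //= stT.
by move: rem le1; lra.
Qed.

Lemma on_track_select S I T i : separated (e := e) S I -> T \subset I ->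
  mwss e w (T :|: S) -> i \in T -> on_track (i |: S) (I :\: closed_nbh e i).
Proof.
move=> sep sTI mT iT; have iI := subsetP sTI i iT.
split; first exact: separated_select.
have stT : stable e T by apply: stableS mT.1; apply: subsetUl.
exists (T :\ i); last first.
  suff -> : T :\ i :|: (i |: S) = T :|: S by [].
  by rewrite setUA; congr (_ :|: _); rewrite setUC setD1K.
apply/subsetP => x; rewrite in_setD1 in_setD_nbh => /andP[-> xT].
by rewrite (subsetP sTI) //= stT.
Qed.

(** Pruning keeps an optimal completion in [J], so [V J + w i 0] is at least [V I] and the
    look-ahead cannot discard [i]. *)
Lemma iteration_optimal S I S1 I1 T i : separated (e := e) S I -> T \subset I ->
  mwss e w (T :|: S) -> i \in T -> iteration e w V i I S I1 S1 ->
  [/\ S1 = i |: S, I1 \subset I :\: closed_nbh e i & on_track S1 I1].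
Proof.
move=> sep sTI mT iT it; have := on_track_select sep sTI mT iT.
have iI := subsetP sTI i iT.
case: it => J _ pJ cmp ot; have otJ := on_track_prune pJ ot; last first.
  by split=> //; apply: prune_sub pJ.
have [sepJ [T' sT'J mT']] := otJ; exfalso.
have dQ := relint_dual_feasible opt.
have := V_SDP_separated dQ sep.
rewrite (dual_optimal_weight perf w_pos opt mT').
rewrite (weight_split sepJ sT'J) (weight_select iI sep).
have := V_SDP_stable dQ (stableS (subsetUl _ _) mT'.1) sT'J.
by move: cmp; lra.
Qed.

(** If [i] lies outside [T], discarding it keeps [T]. Selecting it means that the look-ahead saw no
    loss of value, so [rounds] supplies a new completion. *)
Lemma iteration_on_track Z S I S1 I1 i : rounds (e := e) w Z -> S :|: I \subset Z ->
  on_track S I -> iteration e w V i I S I1 S1 ->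
  S1 :|: I1 \subset Z /\ on_track S1 I1.
Proof.
move=> roundZ sZ [sep [T sTI mT]] it; have [sSZ sIZ] : S \subset Z /\ I \subset Z.
  by apply/andP; rewrite -subUset.
have [iT|iT] := boolP (i \in T).
  have [S1E sI1 ot] := iteration_optimal sep sTI mT iT it; split=> //.
  rewrite S1E !subUset sub1set sSZ (subsetP sIZ) ?(subsetP sTI) //=.
  exact: subset_trans sI1 (subset_trans (subsetDl _ _) sIZ).
case: it => J iI pJ cmp.
  split; first by rewrite subUset sSZ (subset_trans (subD1set _ _)).
  split; first exact: separatedS (subD1set _ _) sep.
  by exists T => //; rewrite subsetD1 sTI.
have sJ := prune_sub pJ.
have sepJ := separatedS sJ (separated_select iI sep).
have sZ' : (i |: S) :|: J \subset Z.
  rewrite !subUset sub1set sSZ (subsetP sIZ) //=.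
  exact: subset_trans sJ (subset_trans (subsetDl _ _) sIZ).
split=> //; split=> //; apply: roundZ => //; apply: separated_extendable => //.
  have dQ := relint_dual_feasible opt.
  rewrite (weight_select iI sep) (dual_optimal_weight perf w_pos opt mT).
  rewrite (weight_split sep sTI) addrA lerD2r.
  apply: le_trans (V_SDP_stable dQ (stableS (subsetUl _ _) mT.1) sTI) _.
  by rewrite leNgt.
exact: prune_stuck pJ.
Qed.

Lemma phase2_on_track Z I S Sout : rounds (e := e) w Z -> phase2 e w V I S Sout ->
  S :|: I \subset Z -> on_track S I -> mwss e w Sout.
Proof.
move=> roundZ; elim=> {I S Sout} [S _ [_ [T]]|i I S I1 S1 Sout it _ IH sZ ot].
  by rewrite subset0 => /eqP->; rewrite set0U.
by have [sZ1 ot1] := iteration_on_track roundZ sZ ot it; apply: IH.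
Qed.

Lemma on_track_start I T : T \subset I -> mwss e w T -> on_track set0 I.
Proof.
move=> sTI mT; split; last by exists T; rewrite ?setU0.
split; first exact: stable0; first by rewrite disjoint_sym disjoints_subset sub0set.
by move=> s j; rewrite inE.
Qed.

Lemma rounding_optimal x X Sout :
  relative_interior (primal_optimal e w) (x, X) -> rounds (e := e) w (phase1 x) ->
  rounding_returns e w V x Sout -> mwss e w Sout.
Proof.
move=> optP roundx p2; have [T mT] := mwss_exists e w.
apply: (phase2_on_track roundx p2); first by rewrite set0U.
exact: on_track_start (mwss_phase1 perf w_pos optP mT) mT.
Qed.

(** Since [i] survives Phase I, it lies in a maximum stable set, so the first iteration selects it
    and stays on track; afterwards all vertices in play lie in [Z]. *)
Lemma rounding_from_optimal x X i Z Sout :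
  relative_interior (primal_optimal e w) (x, X) -> i \in phase1 x ->
  i |: (phase1 x :\: closed_nbh e i) \subset Z -> rounds (e := e) w Z ->
  rounding_returns_from e w V i x Sout -> mwss e w Sout.
Proof.
move=> optP ix sZ roundZ [I1 [S1 [it p2]]].
have [T mT iT] := phase1_mwss e_irr perf w_pos optP ix.
have sTx := mwss_phase1 perf w_pos optP mT.
have [sep _] := on_track_start sTx mT.
have mT0 : mwss e w (T :|: set0) by rewrite setU0.
have [S1E sI1 ot] := iteration_optimal sep sTx mT0 iT it.
apply: (phase2_on_track roundZ p2 _ ot); rewrite S1E setU0.
exact: subset_trans (setUS _ sI1) sZ.
Qed.

End Algorithm.

(** * Perfection of the graph classes and the theorem *)

Section Perfection.
Context {R : realType} {n : nat} {e : rel 'I_n}.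
Context (e_sym : symmetric e) (e_irr : irreflexive e).

Lemma complementK : complement (complement e) = e.
Proof.
apply/funext => i; apply/funext => j; rewrite /complement.
have [->|] := eqVneq i j; first by rewrite e_irr.
by rewrite negbK.
Qed.

Lemma complement_perfect : clique_perfect (R := R) (complement e) ->
  clique_perfect (R := R) e.
Proof.
move=> perf; apply: clique_perfect_tight; rewrite -complementK.
by apply: complement_tight => //; apply: complement_irr.
Qed.

Lemma chordal_perfect : chordal e -> clique_perfect (R := R) e.
Proof. by move=> che; apply: clique_perfect_tight; apply: chordal_tight. Qed.

Lemma unipolar_perfect : unipolar e -> clique_perfect (R := R) e.
Proof. by move=> une; apply: clique_perfect_tight; apply: unipolar_tight. Qed.

End Perfection.

Theorem theorem2p11 (R : realType) (n : nat) (e : rel 'I_n) (w : 'cV[R]_n)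
    (x : 'cV[R]_n) (X : 'M[R]_n) (t : R) (q : 'cV[R]_n) (Q : 'M[R]_n)
    (e_sym : symmetric e) (e_irr : irreflexive e)
    (w_pos : forall i, 0 < w i 0)
    (xX_opt : relative_interior (primal_optimal e w) (x, X))
    (tqQ_opt : relative_interior (dual_optimal e w) (t, q, Q)) :
  (unipolar e \/ chordal e \/ cochordal e ->
   forall S : {set 'I_n},
     rounding_returns e w (V_SDP q Q) x S -> mwss e w S)
  /\
  (counipolar e ->
   forall i j : 'I_n, e i j -> i \in phase1 x -> j \in phase1 x ->
     (forall S : {set 'I_n},
        rounding_returns_from e w (V_SDP q Q) i x S -> mwss e w S)
     \/
     (forall S : {set 'I_n},
        rounding_returns_from e w (V_SDP q Q) j x S -> mwss e w S)).
Proof.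
have w_ge0 i : 0 <= w i 0 by apply: ltW.
have c_sym := complement_sym e_sym; have c_irr := complement_irr (e := e).
split.
  move=> classes S.
  have perf : clique_perfect (R := R) e.
    case: classes => [une|[che|cce]]; first exact: unipolar_perfect.
      exact: chordal_perfect.
    by apply: complement_perfect => //; apply: chordal_perfect.
  apply: (rounding_optimal e_sym e_irr perf w_pos tqQ_opt xX_opt).
  case: classes => [une|[che|cce]].
  - apply: unipolar_rounds => // i; exact: (phase1_mwss e_irr perf w_pos xX_opt).
  - exact: chordal_rounds.
  - exact: cochordal_rounds.
move=> cue i j eij ix jx.
have perf : clique_perfect (R := R) e.
  by apply: complement_perfect => //; apply: unipolar_perfect.
have [A [clA clB]] := cue.
have stA : stable e A.
  move=> x' y xA yA; apply/negP => xy.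
  have nxy : x' != y by apply: contraTneq xy => ->; rewrite e_irr.
  by have := clA x' y xA yA nxy; rewrite /complement xy andbF.
(* Outside [A], the non-neighbours of [k] lie in its component of the complement, which is stable in
   [e]. With the stable set [A], what remains is bipartite. *)
have from k : k \notin A -> k \in phase1 x -> forall S : {set 'I_n},
    rounding_returns_from e w (V_SDP q Q) k x S -> mwss e w S.
  move=> kA kx S.
  have kcA : k \in (~: A)%SET by rewrite inE.
  pose B := component (complement e) (~: A)%SET k.
  have stB : stable e B.
    move=> x' y xB yB; apply/negP => xy.
    have nxy : x' != y by apply: contraTneq xy => ->; rewrite e_irr.
    by have := clB k kcA x' y xB yB nxy; rewrite /complement xy andbF.
  apply: (rounding_from_optimal e_sym e_irr perf w_pos tqQ_opt xX_opt kx
    (Z := (A :|: B)%SET)); last first.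
    exact: bipartite_rounds.
  have kB : k \in B by apply: component_refl.
  apply/subsetP => y; rewrite in_setU1 in_setU in_setD_nbh => /orP[/eqP->|/and3P[_ yk nky]].
    by rewrite kB orbT.
  have [//|yA] := boolP (y \in A).
  apply: (component_closed kB); first by rewrite inE.
  by rewrite /complement eq_sym yk.
(* Two adjacent vertices cannot both lie in the stable set [A]. *)
have [iA|iA] := boolP (i \in A); last by left; apply: from.
right; apply: from => //; apply: contraL eij => jA; exact: stA.
Qed.
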